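(* There exists a countably infinite ordered directed graph $\Delta$ which is homogeneous and Ramsey such that the problems $\operatorname{Expr}_{\operatorname{pp}}(\Delta)$ and $\operatorname{Expr}_{\operatorname{ep}}(\Delta)$ are undecidable.
   Context: An ordered directed graph is a structure with signature $\{E,<\}$, where $E$ is a binary (edge) relation and $<$ denotes a linear order on the vertices. Substructures are always induced. The age of a structure is the class of all finite structures of the same signature that embed into it. A structure with age $\mathcal C$ is Ramsey iff for all $k\ge 1$ and all $H,P\in\mathcal C$ there is $S\in\mathcal C$ such that for every coloring with $k$ colors of the copies of $P$ in $S$ (i.e. substructures of $S$ isomorphic to $P$) there is a copy of $H$ in $S$ all of whose copies of $P$ have the same color. A structure is homogeneous iff every isomorphism between finite induced substructures extends to an automorphism of the whole structure. A first-order formula is primitive positive iff it is of the form $\exists y_1\ldots\exists y_m.\,\psi$ with $\psi$ a conjunction of atomic formulas (equality allowed); it is existential positive iff it is of the form $\exists y_1\ldots\exists y_m.\,\psi$ with $\psi$ quantifier-free and without negations. For a fixed structure $\Gamma$ with finite relational signature $\sigma$, the problem $\operatorname{Expr}_{\operatorname{pp}}(\Gamma)$ (respectively $\operatorname{Expr}_{\operatorname{ep}}(\Gamma)$) is the following. Input: quantifier-free $\sigma$-formulas $\phi_0,\phi_1,\dots,\phi_n$ (equality allowed), each with a given list of free variables, defining relations $R_0,R_1,\dots,R_n$ over the domain $D$ of $\Gamma$. Question: is there a primitive positive (respectively existential positive) formula over a signature consisting of symbols for $R_1,\dots,R_n$ which defines $R_0$ in the structure $(D;R_1,\dots,R_n)$?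 *)

(* Defs.v *)
From Stdlib Require List.
From HB Require Import structures.
From mathcomp Require Import all_boot.
From mathcomp Require Import boolp classical_sets functions cardinality.

Set Implicit Arguments.
Unset Strict Implicit.
Unset Printing Implicit Defensive.

Local Open Scope classical_set_scope.

(** * Relational structures *)

Record signature := Signature {
  symbol :> finType;
  arity : symbol -> nat
}.

Record structure (sigma : signature) := Structure {
  domain :> Type;
  interp : forall s : sigma, (arity s).-tuple domain -> Prop
}.

Section Structures.
Variable sigma : signature.
Implicit Types A B C P H S : structure sigma.

Definition embedding A B (f : A -> B) : Prop :=
  injective f /\
  forall (s : sigma) (t : (arity s).-tuple A),
    interp t <-> interp (map_tuple f t).

Definition isomorphism A B (f : A -> B) : Prop :=
  embedding f /\ bijective f.

Definition isomorphic A B : Prop := exists f : A -> B, isomorphism f.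

Definition induced A (X : set A) : structure sigma :=
  @Structure sigma X (fun s t => interp (map_tuple (fun x : X => val x) t)).

Definition in_age A C : Prop :=
  finite_set [set: C] /\ exists f : C -> A, embedding f.

(* A copy of [P] in [S] is identified with its vertex set. *)
Definition copy P S (X : set S) : Prop := isomorphic P (induced X).

Definition ramsey A : Prop :=
  forall (k : nat) H P, 0 < k -> in_age A H -> in_age A P ->
    exists2 S, in_age A S &
      forall chi : set S -> 'I_k,
        exists2 X : set S, copy H X &
          exists i : 'I_k,
            forall Y : set S, copy P Y -> Y `<=` X -> chi Y = i.

Definition homogeneous A : Prop :=
  forall (X Y : set A) (f : induced X -> induced Y),
    finite_set X -> finite_set Y -> isomorphism f ->
    exists2 g : A -> A, isomorphism g &
      forall x : induced X, g (val x) = val (f x).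

End Structures.

(** * First-order formulas *)

(* Variables are natural numbers.  There are no constants for truth values. *)
Inductive formula (sigma : signature) : Type :=
| FAtom (s : sigma) of (arity s).-tuple nat
| FEq of nat & nat
| FNot of formula sigma
| FAnd of formula sigma & formula sigma
| FOr of formula sigma & formula sigma
| FEx of nat & formula sigma
| FAll of nat & formula sigma.

Arguments FEq {sigma}.

Section Formulas.
Variable sigma : signature.
Implicit Types phi psi : formula sigma.

Fixpoint sat (A : structure sigma) (e : nat -> A) phi : Prop :=
  match phi with
  | FAtom s xs => interp (map_tuple e xs)
  | FEq x y => e x = e y
  | FNot p => ~ sat e p
  | FAnd p q => sat e p /\ sat e q
  | FOr p q => sat e p \/ sat e q
  | FEx x p => exists a : A, sat [eta e with x |-> a] p
  | FAll x p => forall a : A, sat [eta e with x |-> a] p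
  end.

Fixpoint free_vars phi : seq nat :=
  match phi with
  | FAtom s xs => xs
  | FEq x y => [:: x; y]
  | FNot p => free_vars p
  | FAnd p q | FOr p q => free_vars p ++ free_vars q
  | FEx x p | FAll x p => [seq y <- free_vars p | y != x]
  end.

Fixpoint quantifier_free phi : bool :=
  match phi with
  | FAtom _ _ | FEq _ _ => true
  | FNot p => quantifier_free p
  | FAnd p q | FOr p q => quantifier_free p && quantifier_free q
  | FEx _ _ | FAll _ _ => false
  end.

Fixpoint negation_free phi : bool :=
  match phi with
  | FAtom _ _ | FEq _ _ => true
  | FNot _ => false
  | FAnd p q | FOr p q => negation_free p && negation_free q
  | FEx _ p | FAll _ p => negation_free p
  end.

Fixpoint conjunction_of_atoms phi : bool :=
  match phi with
  | FAtom _ _ | FEq _ _ => true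
  | FAnd p q => conjunction_of_atoms p && conjunction_of_atoms q
  | _ => false
  end.

Definition exists_block (ys : seq nat) psi : formula sigma :=
  foldr (@FEx sigma) psi ys.

Definition primitive_positive phi : Prop :=
  exists (ys : seq nat) psi,
    phi = exists_block ys psi /\ conjunction_of_atoms psi.

Definition existential_positive phi : Prop :=
  exists (ys : seq nat) psi,
    [/\ phi = exists_block ys psi, quantifier_free psi & negation_free psi].

Definition defines (A : structure sigma) phi (k : nat)
    (R : k.-tuple A -> Prop) : Prop :=
  exists xs : k.-tuple nat,
    [/\ uniq xs, {subset free_vars phi <= xs} &
        forall e : nat -> A, sat e phi <-> R (map_tuple e xs)].

(* A quantifier-free formula with an explicit list of free variables, which
   may contain variables that do not occur in the formula. *)
Record qf_def := QfDef {
  qf_vars : seq nat;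
  qf_body : formula sigma;
  _ : [&& uniq qf_vars, quantifier_free qf_body
        & all (mem qf_vars) (free_vars qf_body)]
}.

Definition relation_of (A : structure sigma) (d : qf_def) :
    (size (qf_vars d)).-tuple A -> Prop :=
  fun t => exists2 e : nat -> A,
    [seq e x | x <- qf_vars d] = t & sat e (qf_body d).

End Formulas.

(** * The expressibility problems *)

Section Expressibility.
Variable sigma : signature.

Definition def_signature (ds : seq (qf_def sigma)) : signature :=
  @Signature 'I_(size ds)
    (fun i => size (qf_vars (tnth (in_tuple ds) i))).

Definition def_structure (A : structure sigma) (ds : seq (qf_def sigma)) :
    structure (def_signature ds) :=
  @Structure (def_signature ds) A
    (fun i => @relation_of sigma A (tnth (in_tuple ds) i)).

(* The input phi_0, phi_1, ..., phi_n is (phi_0, [:: phi_1; ...; phi_n]). *)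
Definition expr_instance : Type := qf_def sigma * seq (qf_def sigma).

Definition Expr_pp (A : structure sigma) (I : expr_instance) : Prop :=
  exists2 phi : formula (def_signature I.2), primitive_positive phi &
    @defines _ (def_structure A I.2) phi _ (@relation_of sigma A I.1).

Definition Expr_ep (A : structure sigma) (I : expr_instance) : Prop :=
  exists2 phi : formula (def_signature I.2), existential_positive phi &
    @defines _ (def_structure A I.2) phi _ (@relation_of sigma A I.1).

(* Goedel numbering of the inputs; [CodeSeq.code] is an explicit computable
   bijection from [seq nat] to [nat]. *)
Fixpoint formula_code (phi : formula sigma) : nat :=
  match phi with
  | FAtom s xs => CodeSeq.code [:: 0, (enum_rank s : nat) & xs]
  | FEq x y => CodeSeq.code [:: 1; x; y]
  | FNot p => CodeSeq.code [:: 2; formula_code p]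
  | FAnd p q => CodeSeq.code [:: 3; formula_code p; formula_code q]
  | FOr p q => CodeSeq.code [:: 4; formula_code p; formula_code q]
  | FEx x p => CodeSeq.code [:: 5; x; formula_code p]
  | FAll x p => CodeSeq.code [:: 6; x; formula_code p]
  end.

Definition qf_def_code (d : qf_def sigma) : nat :=
  CodeSeq.code [:: CodeSeq.code (qf_vars d); formula_code (qf_body d)].

Definition expr_code (I : expr_instance) : nat :=
  CodeSeq.code [seq qf_def_code d | d <- I.1 :: I.2].

Let code_inj : injective CodeSeq.code := can_inj CodeSeq.codeK.

Lemma formula_code_inj : injective formula_code.
Proof.
elim=> [s xs|x y|p IHp|p IHp q IHq|p IHp q IHq|x p IHp|x p IHp];
  case=> [s' xs'|x' y'|p'|p' q'|p' q'|x' p'|x' p'] /code_inj //.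
- case=> /val_inj/enum_rank_inj ss'.
  by rewrite -ss' in xs' * => /val_inj ->.
- by case=> -> ->.
- by case=> /IHp ->.
- by case=> /IHp -> /IHq ->.
- by case=> /IHp -> /IHq ->.
- by case=> -> /IHp ->.
- by case=> -> /IHp ->.
Qed.

Lemma expr_code_inj : injective expr_code.
Proof.
have qf_inj : injective qf_def_code.
  move=> [v p h] [v' p' h'] /code_inj[/code_inj/= ev /formula_code_inj/= ep].
  by rewrite -ev -ep in h' *; rewrite (bool_irrelevance h h').
by move=> [d ds] [d' ds'] /code_inj[/qf_inj -> /(inj_map qf_inj) ->].
Qed.

End Expressibility.

(** * Computability *)

(* Kleene's partial recursive functions.  The syntax is arity-free: a term
   denotes a partial function on lists of arguments, of every length. *)
Inductive recfun : Type :=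
| RZero
| RSucc
| RProj of nat
| RComp of recfun & seq recfun
| RPrim of recfun & recfun
| RMin of recfun.

Inductive rec_eval : recfun -> seq nat -> nat -> Prop :=
| eval_zero xs : rec_eval RZero xs 0
| eval_succ x xs : rec_eval RSucc (x :: xs) x.+1
| eval_proj i xs : i < size xs -> rec_eval (RProj i) xs (nth 0 xs i)
| eval_comp f gs xs ys z :
    List.Forall2 (fun g y => rec_eval g xs y) gs ys ->
    rec_eval f ys z -> rec_eval (RComp f gs) xs z
| eval_prim0 f g xs z :
    rec_eval f xs z -> rec_eval (RPrim f g) (0 :: xs) z
| eval_primS f g n xs y z :
    rec_eval (RPrim f g) (n :: xs) y -> rec_eval g [:: n, y & xs] z ->
    rec_eval (RPrim f g) (n.+1 :: xs) z
| eval_min f xs n :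
    (forall m, m < n -> exists k, rec_eval f (m :: xs) k.+1) ->
    rec_eval f (n :: xs) 0 -> rec_eval (RMin f) xs n.

(* The decision problem [L] on inputs of type [I], numbered by [code], is
   solved by a recursive function (no constraint outside the range of
   [code]). *)
Definition recursively_decidable (I : Type) (code : I -> nat)
    (L : I -> Prop) : Prop :=
  exists f : recfun, forall i : I,
    (L i -> rec_eval f [:: code i] 1) /\ (~ L i -> rec_eval f [:: code i] 0).

Definition undecidable (I : Type) (code : I -> nat) (L : I -> Prop) : Prop :=
  ~ recursively_decidable code L.

(** * Ordered directed graphs *)

Inductive odg_symbol : Type := Edge | Less.

Definition bool_of_odg (s : odg_symbol) : bool := if s is Edge then true else false.
Definition odg_of_bool (b : bool) : odg_symbol := if b then Edge else Less.
Lemma bool_of_odgK : cancel bool_of_odg odg_of_bool. Proof. by case. Qed.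

HB.instance Definition _ := Finite.copy odg_symbol (can_type bool_of_odgK).

Definition odg_signature : signature := @Signature odg_symbol (fun=> 2).

(* The edge relation is an arbitrary binary relation; [Less] is a strict
   linear order. *)
Definition ordered_digraph (A : structure odg_signature) : Prop :=
  let lt (x y : A) := @interp _ A Less [tuple x; y] in
  [/\ forall x, ~ lt x x,
      forall x y z, lt x y -> lt y z -> lt x z &
      forall x y, [\/ lt x y, x = y | lt y x]].

(* Main.v *)
Require Import Defs.
From mathcomp Require Import all_boot.
From mathcomp Require Import boolp classical_sets functions cardinality.
From mathcomp Require Import order ssralg ssrnum rat.
From Stdlib Require List.

Set Implicit Arguments.
Unset Strict Implicit.
Unset Printing Implicit Defensive.

Import Order.TTheory GRing.Theory Num.Theory.

(** The structure is a Fraisse limit whose age encodes a set of numbers that no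
    recursive function decides.

    Let [T_n] be the ordered digraph on [n + 3] points, any two of them
    adjacent, coloured by [pattern n].  No [T_n] embeds into another one
    ([pattern_rigid]).  For a set [N] of numbers, the finite loopless ordered
    digraphs that omit all [T_n] with [n] in [N] form an amalgamation class,
    because two members can be amalgamated without new edges and a [T_n] has no
    two non-adjacent points.  Hence the class has a homogeneous limit, in which
    [T_n] embeds if and only if [n] is not in [N].

    _The reduction._  Let [R0(x, y)] say [x < y] and let [R1(x, y, z)] say that
    [x < y] and the tuple [z] induces [T_n].  If [T_n] embeds then
    [exists z, R1(x, y, z)] defines [R0].  If it does not, then [R1] is empty, so
    every formula over [R1] is invariant under all permutations of the domain
    ([sat_bijective]) and none of them defines an order.  So both expressibility
    problems, restricted to these inputs, are the complement of [N].  Taking for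
    [N] the set of codes of the recursive functions that accept the input
    numbered by their own code, no recursive function decides either problem.

    _The Ramsey property._  This is the Nesetril-Rodl theorem for ordered
    structures with forbidden cliques, proved here by the partite construction
    ([clique_preserving_Ramsey]).  A picture is a finite structure projected to a
    linear order.  The Hales-Jewett theorem turns a picture and a transversal
    spot [s] into a larger picture in which every colouring of the copies over
    [s] is constant on some copy of the old picture ([partite_step]).  Doing this
    for all spots leaves a colouring of the spots, to which a Ramsey statement
    about the base applies ([partite_round]).  Over an initial segment of the
    numbers that statement is Ramsey's theorem, and the outcome is a Ramsey
    structure without control over its cliques.  Running the construction again
    with this structure as base makes all projections homomorphisms.  A clique
    that is glued together from several copies of the old picture then projects
    injectively to a copy of the coloured structure, so no new clique arises. *)

(** * The Hales-Jewett theorem *)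
Section HalesJewett.
Variable A : finType.

(** A combinatorial line in the cube over [I]: the coordinates with value [None]
    move together, the others are fixed. *)
Definition line (I : finType) (l : {ffun I -> option A}) : bool :=
  [exists i, l i == None].

Definition line_point (I : finType) (l : {ffun I -> option A}) (x : A) :
  {ffun I -> A} := [ffun i => odflt x (l i)].

Definition const_word (I : finType) (w : {ffun I -> A}) : {ffun I -> option A} :=
  [ffun i => Some (w i)].

Definition word_join (B : Type) (I J : finType) (u : {ffun I -> B})
    (v : {ffun J -> B}) : {ffun I + J -> B} :=
  [ffun k => match k with inl i => u i | inr j => v j end].

Lemma line_point_join (I J : finType) (l : {ffun I -> option A})
    (m : {ffun J -> option A}) x :
  line_point (word_join l m) x = word_join (line_point l x) (line_point m x).
Proof. by apply/ffunP=> -[i|j]; rewrite !ffunE. Qed.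

Lemma line_point_const (I : finType) (w : {ffun I -> A}) x :
  line_point (const_word w) x = w.
Proof. by apply/ffunP=> i; rewrite !ffunE. Qed.

Lemma line_word_joinl (I J : finType) (l : {ffun I -> option A})
    (m : {ffun J -> option A}) : line l -> line (word_join l m).
Proof. by case/existsP=> i li; apply/existsP; exists (inl i); rewrite ffunE. Qed.

Lemma line_word_joinr (I J : finType) (l : {ffun I -> option A})
    (m : {ffun J -> option A}) : line m -> line (word_join l m).
Proof. by case/existsP=> j mj; apply/existsP; exists (inr j); rewrite ffunE. Qed.

Definition mono_on (S : {set A}) (K : Type) (I : finType)
    (C : {ffun I -> A} -> K) (l : {ffun I -> option A}) : Prop :=
  {in S &, forall x y, C (line_point l x) = C (line_point l y)}.

(** The theorem for lines that are traversed by the letters of [S] only.  Words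
    may use all letters, so that an induction on [S] never changes the alphabet. *)
Definition HJ_for (S : {set A}) : Prop :=
  forall K : finType, exists I : finType, forall C : {ffun I -> A} -> K,
    exists2 l, line l & mono_on S C l.

(** Lines that are monochromatic on [S], have different colours, and all meet in
    one word [f] when the new letter [a0] is put in. *)
Definition focused (S : {set A}) (x0 a0 : A) (K : eqType) (I : finType)
    (C : {ffun I -> A} -> K) (ls : seq {ffun I -> option A}) : Prop :=
  uniq [seq C (line_point l x0) | l <- ls] /\
  exists f, {in ls, forall l, [/\ line l, line_point l a0 = f & mono_on S C l]}.

(** Colour focusing.  The cube over [I + J] is seen as a colouring of the
    [J]-cube whose colours are the colourings of the [I]-cube.  A line of the
    [J]-cube that is monochromatic on [S] makes the colouring of the [I]-cube
    independent of the letter of [S] put into that line.  The focused lines found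
    there, moved along the new line, keep their colours, and the focus itself,
    moved along the new line, is one more line; if its colour is not new, then
    a focused line already is monochromatic on [a0 |: S]. *)
Lemma focusing (S : {set A}) (x0 a0 : A) : x0 \in S -> HJ_for S ->
  forall (K : finType) (r : nat), exists I : finType,
  forall C : {ffun I -> A} -> K,
    (exists2 ls, size ls = r & focused S x0 a0 C ls) \/
    (exists2 l, line l & mono_on (a0 |: S) C l).
Proof.
move=> x0S hjS K; elim=> [|r [I IH]].
  exists unit => C; left; exists [::] => //; split=> //.
  by exists [ffun=> a0].
have [J HJ] := hjS {ffun {ffun I -> A} -> K}.
exists (I + J)%type => C.
have [m lm mm] := HJ (fun v => [ffun u => C (word_join u v)]).
pose D u := C (word_join u (line_point m x0)).
have Dm x u : x \in S -> C (word_join u (line_point m x)) = D u.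
  by move=> xS; have /ffunP/(_ u) := mm x x0 xS x0S; rewrite !ffunE.
have lift l : line l -> mono_on (a0 |: S) D l ->
    exists2 l', line l' & mono_on (a0 |: S) C l'.
  move=> ll ml; exists (word_join l (const_word (line_point m x0))).
    exact: line_word_joinl.
  by move=> x y xS yS; rewrite !line_point_join !line_point_const; apply: ml.
case: (IH D) => [[ls sls [uls [f Hls]]]|[l ll ml]]; last by right; apply: lift ml.
have [|ncol] := boolP (D f \in [seq D (line_point l x0) | l <- ls]).
  case/mapP=> l lls Df; have [ll lf ml] := Hls l lls; right; apply: lift (ll) _.
  have eqx x : x \in a0 |: S -> D (line_point l x) = D f.
    by case/setU1P=> [->|xS]; [rewrite lf | rewrite Df; apply: ml].
  by move=> x y /eqx-> /eqx->.
left; exists (word_join (const_word f) m :: [seq word_join l m | l <- ls]).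
  by rewrite /= size_map sls.
split.
  rewrite /= -map_comp line_point_join line_point_const Dm //.
  rewrite (@eq_map _ _ _ (fun l => D (line_point l x0))) ?ncol //.
  by move=> l /=; rewrite line_point_join Dm.
exists (word_join f (line_point m a0)) => l'; rewrite inE => /predU1P[->|/mapP[l lls ->]].
  split; first exact: line_word_joinr.
    by rewrite line_point_join line_point_const.
  by move=> x y xS yS; rewrite !line_point_join !line_point_const !Dm.
have [ll lf ml] := Hls l lls; split; first exact: line_word_joinl.
  by rewrite line_point_join lf.
by move=> x y xS yS; rewrite !line_point_join !Dm //; apply: ml.
Qed.

(** More focused lines than colours are impossible, so [focusing] with
    [#|L|.+1] lines adds a letter to [S]. *)
Theorem Hales_Jewett (K : finType) : exists I : finType,
  forall C : {ffun I -> A} -> K,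
  exists2 l, line l & forall x y, C (line_point l x) = C (line_point l y).
Proof.
suff hjS (S : {set A}) : HJ_for S.
  by have [I HI] := hjS [set: A]%SET K; exists I => C; have [l ll ml] := HI C;
     exists l => // x y; apply: ml; rewrite inE.
move: {2}#|S| (leqnn #|S|) => n; elim: n S => [|n IH] S.
  rewrite leqn0 cards_eq0 => /eqP-> L; exists unit => C.
  exists [ffun=> None]; first by apply/existsP; exists tt; rewrite ffunE.
  by move=> x y; rewrite inE.
move=> sS; have [->|[a0 a0S]] := set_0Vmem S; first by apply: IH; rewrite cards0.
have{sS} sS' : #|S :\ a0| <= n by move: sS; rewrite (cardsD1 a0) a0S.
rewrite -(finset.setD1K a0S) => L; have [->|[x0 x0S]] := set_0Vmem (S :\ a0).
  exists unit => C; exists [ffun=> None].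
    by apply/existsP; exists tt; rewrite ffunE.
  by move=> x y; rewrite finset.setU0 !inE => /eqP-> /eqP->.
have [I HI] := focusing a0 x0S (IH _ sS') L #|L|.+1.
exists I => C; case: (HI C) => // -[ls sls [uls _]].
have := max_card (mem [seq C (line_point l x0) | l <- ls]).
by rewrite (card_uniqP uls) size_map sls ltnn.
Qed.

End HalesJewett.

(** * Ramsey's theorem for finite sets of numbers *)
Lemma sum_count_eq (T : Type) (L : finType) (c : T -> L) (s : seq T) :
  \sum_(i : L) count (fun x => c x == i) s = size s.
Proof.
elim: s => [|x s IH] /=; first by rewrite big1.
by rewrite big_split /= IH (bigD1 (c x)) //= eqxx big1 // => i;
   rewrite eq_sym => /negPf->.
Qed.

Definition constant_on (L : Type) (chi : seq nat -> L) (a : nat) (Y : seq nat) :=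
  exists i, forall Z, sorted ltn Z -> {subset Z <= Y} -> size Z = a -> chi Z = i.

(** The usual induction on the size of the coloured sets: inside a large set one
    finds a set [V] in which the colour of a subset depends on its least element
    only, and then the pigeonhole principle applies to these elements. *)
Theorem finite_Ramsey (L : finType) (a b : nat) : L -> exists p,
  forall W, sorted ltn W -> p <= size W -> forall chi : seq nat -> L,
  exists2 Y, subseq Y W & size Y = b /\ constant_on chi a Y.
Proof.
move=> i0; elim: a b => [|a IHa] b.
  exists b => W sW bW chi; exists (take b W); first exact: take_subseq.
  rewrite size_takel //; split=> //.
  by exists (chi [::]) => Z _ _ /size0nil->.
have ltn_tr : transitive ltn by move=> x y z; apply: ltn_trans.
(* The least element [x] of the large set is kept, and the colouring of the
   [a]-subsets induced by [x] is made constant before the other elements are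
   chosen. *)
have end_hom n : exists p, forall W, sorted ltn W -> p <= size W ->
    forall chi : seq nat -> L, exists2 V, subseq V W & size V = n /\
      exists c : nat -> L, forall x Z, x \in V -> {subset Z <= V} ->
        sorted ltn (x :: Z) -> size Z = a -> chi (x :: Z) = c x.
  elim: n => [|n [p IHn]].
    by exists 0 => W sW _ chi; exists [::]; rewrite ?sub0seq //; split=> //;
       exists (fun=> i0).
  have [q Hq] := IHa p; exists q.+1 => -[|x W] //= sW qW chi.
  have sW' := path_sorted sW.
  have [Y YW [sY [i Yi]]] := Hq W sW' qW (fun Z => chi (x :: Z)).
  have [|V VY [sV [c Vc]]] := IHn Y (subseq_sorted ltn_tr YW sW') _ chi.
    by rewrite sY.
  have VW := subseq_trans VY YW.
  exists (x :: V); first by rewrite /= eqxx.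
  split; first by rewrite /= sV.
  have xV y : y \in V -> x < y.
    by move=> /(mem_subseq VW); apply/allP: y; apply: order_path_min sW.
  exists (fun y => if y == x then i else c y) => y Z yV ZV yZ sZ.
  have ltyZ z : z \in Z -> y < z.
    by apply/allP: z; apply: order_path_min yZ.
  have leqxy : x <= y by move: yV; rewrite inE => /predU1P[->|/xV/ltnW].
  have ZV' : {subset Z <= V}.
    move=> z zZ; have := ZV z zZ; rewrite inE => /predU1P[zx|//].
    by have := leq_ltn_trans leqxy (ltyZ z zZ); rewrite zx ltnn.
  case: eqP => [->|/eqP yx].
    apply: Yi => //; first exact: path_sorted yZ.
    by move=> z /ZV' /(mem_subseq VY).
  by apply: Vc => //; move: yV; rewrite inE (negPf yx).
have [p Hp] := end_hom (#|L| * b).+1.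
exists p => W sW pW chi; have [V VW [sV [c Vc]]] := Hp W sW pW chi.
have [i bi] : exists i, b <= count (fun x => c x == i) V.
  apply: contrapT => /forallNP no; have := sum_count_eq c V.
  suff : \sum_(i : L) count (fun x => c x == i) V <= #|L| * b.
    by move=> le eq; move: le; rewrite eq sV ltnn.
  rewrite -sum_nat_const; apply: leq_sum => i _.
  by apply: ltnW; rewrite ltnNge; apply/negP/no.
set Y := take b [seq x <- V | c x == i].
have YV : {subset Y <= [seq x <- V | c x == i]} by move=> x /mem_take.
exists Y.
  exact: subseq_trans (take_subseq _ _) (subseq_trans (filter_subseq _ _) VW).
split; first by rewrite size_takel // size_filter.
exists i => -[|x Z] //= sZ ZY [sizeZ].
have : x \in Y by apply: ZY; rewrite inE eqxx.
move=> /YV; rewrite mem_filter => /andP[/eqP cxi xV].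
rewrite -cxi; apply: Vc => // z zZ.
have : z \in Y by apply: ZY; rewrite inE zZ orbT.
by move=> /YV; rewrite mem_filter => /andP[].
Qed.

(** * The partite construction: one step *)
Section Pictures.
Variables (K : eqType) (c0 : K).

(** [pos] projects the vertices to a line; its fibres are the parts.  Only the
    colours [col x y] with [pos x < pos y] matter, and [c0] means no edge. *)
Record picture := Picture {
  vertex :> finType;
  pos : vertex -> nat;
  col : vertex -> vertex -> K
}.

Definition emb (P Q : picture) (f : P -> Q) : Prop :=
  forall x y, pos x < pos y ->
    pos (f x) < pos (f y) /\ col (f x) (f y) = col x y.

(** All parts are singletons, so that the picture is an ordered structure. *)
Definition ordered_by_pos (P : picture) : Prop := injective (@pos P).

Definition clique (P : picture) : Prop :=
  forall x y : P, pos x < pos y -> col x y != c0.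

Lemma emb_comp (P Q R : picture) (f : P -> Q) (g : Q -> R) :
  emb f -> emb g -> emb (g \o f).
Proof. by move=> ef eg x y /ef[/eg[? e] <-]. Qed.

Lemma linear_lt (P : picture) (x y : P) :
  ordered_by_pos P -> x != y -> pos x < pos y \/ pos y < pos x.
Proof.
move=> lP; case: (ltngtP (pos x) (pos y)) => [||/lP->]; rewrite ?eqxx //; auto.
Qed.

Definition increasing (P : picture) (s : P -> nat) : Prop :=
  forall x y, pos x < pos y -> s x < s y.

Lemma increasing_inv (P : picture) (s : P -> nat) :
  ordered_by_pos P -> increasing s -> forall x y, s x < s y -> pos x < pos y.
Proof.
move=> lP incs x y lt; have /(linear_lt lP)[//|/incs] : x != y.
  by apply: contraTneq lt => ->; rewrite ltnn.
by rewrite ltnNge (ltnW lt).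
Qed.

Lemma increasing_inj (P : picture) (s : P -> nat) :
  ordered_by_pos P -> increasing s -> injective s.
Proof.
move=> lP incs x y eqs; apply/eqP; apply: contraT => /(linear_lt lP)[] /incs;
by rewrite eqs ltnn.
Qed.

(** [s] is a spot for [A] on the line and [t] a transversal copy of [A] above it. *)
Definition lies_over (A P : picture) (s : A -> nat) (t : A -> P) : Prop :=
  emb t /\ forall a, pos (t a) = s a.

(** The projection of [P] to the structure [cX] on the line preserves edges, but
    not necessarily non-edges. *)
Definition hom (P : picture) (cX : nat -> nat -> K) : Prop :=
  forall x y : P, pos x < pos y -> col x y != c0 -> cX (pos x) (pos y) = col x y.

Definition patterned (A : picture) (cX : nat -> nat -> K) (s : A -> nat) : Prop :=
  forall a a', pos a < pos a' -> cX (s a) (s a') = col a a'.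

(** Structures with one vertex are excluded because the construction creates
    isolated vertices outside all copies. *)
Definition clique_below (P' P A : picture) : Prop :=
  forall T, ordered_by_pos T -> clique T -> 1 < #|T| ->
    (exists f : T -> P', emb f) ->
    (exists f : T -> P, emb f) \/ (exists f : T -> A, emb f).

Definition over_emb (P P' : picture) (f : P -> P') : Prop :=
  emb f /\ forall x, pos (f x) = pos x.

(** From now on [I] is the index set of a cube whose letters are the copies of
    [A] over the spot [s].  The parts of [P] above [s] are replaced by the words
    over their vertices.  A combinatorial line [l] yields a copy of [P]: a vertex
    above the spot goes to the word that has it at the moving coordinates and the
    vertex of [l j] in the same part at each fixed coordinate [j]; the other
    vertices are duplicated for every line.  The edges of the new picture are
    those of these copies. *)
Section Step.
Variables (A P : picture) (s : {ffun A -> nat}).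
Hypotheses (linA : ordered_by_pos A) (incs : increasing s).

Let Sigma : finType := {t : {ffun A -> P} | `[< lies_over s t >]}.
Variable I : finType.
Let lines := {ffun I -> option Sigma}.

Definition spot_of (v : P) : option A := [pick a | s a == pos v].

Definition step_vertex : finType := ({ffun I -> P} + lines * P)%type.

Definition step_inj (l : lines) (v : P) : step_vertex :=
  if spot_of v is Some a
  then inl [ffun j => if l j is Some t then val t a else v]
  else inr (l, v).

Definition step_pos (x : step_vertex) : nat :=
  match x with
  | inl f => if [pick j : I] is Some j then pos (f j) else 0
  | inr (_, v) => pos v
  end.

Definition step_edge (x y : step_vertex) : pred (lines * (P * P)) :=
  fun z => [&& line z.1, step_inj z.1 z.2.1 == x, step_inj z.1 z.2.2 == y
             & pos z.2.1 < pos z.2.2].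

Definition step_col (x y : step_vertex) : K :=
  if [pick z | step_edge x y z] is Some z then col z.2.1 z.2.2 else c0.

Definition step_picture := Picture step_pos step_col.

Lemma step_pos_inj l v : line l -> step_pos (step_inj l v) = pos v.
Proof.
case/existsP=> j0 _; rewrite /step_inj /spot_of.
case: pickP => [a /eqP sa|//] /=; case: pickP => [j _|/(_ j0)//].
by rewrite ffunE; case: (l j) => // t; case/asboolP: (valP t) => _ ->.
Qed.

Lemma spot_ofP v a : (spot_of v == Some a) = (s a == pos v).
Proof.
rewrite /spot_of; case: pickP => [b /eqP sb|/(_ a)->//].
apply/eqP/eqP => [[<-//]|sa]; congr Some.
by apply: increasing_inj incs _ _ _ => //; rewrite sa.
Qed.

Lemma step_inj_inr l v l' u : step_inj l v = inr (l', u) -> l = l' /\ v = u.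
Proof. by rewrite /step_inj; case: spot_of => // -[]. Qed.

Lemma step_injK l : line l -> injective (step_inj l).
Proof.
case/existsP=> j /eqP lj u v; rewrite /step_inj.
case: (spot_of u) => [a|]; case: (spot_of v) => [b|] // [].
by move=> /ffunP/(_ j); rewrite !ffunE lj.
by [].
Qed.

(** The copies of [P] given by two lines agree on common pairs.  Vertices not
    above the spot determine their line.  For two pairs above it, if some
    coordinate moves on both lines, then the vertices read off there coincide.
    Otherwise each pair is, at a moving coordinate of its line, read off from
    a copy of [A] given by the other line, so both have the colour of [A]. *)
Lemma step_col_wd l u v l' u' v' : line l -> line l' ->
  step_inj l u = step_inj l' u' -> step_inj l v = step_inj l' v' ->
  pos u < pos v -> col u v = col u' v'.
Proof.
move=> ll ll' eu ev lt.
have pu : pos u' = pos u by rewrite -(step_pos_inj u ll) eu step_pos_inj.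
have pv : pos v' = pos v by rewrite -(step_pos_inj v ll) ev step_pos_inj.
have same : l = l' -> col u v = col u' v'.
  by move=> ell; rewrite -ell in eu ev; rewrite (step_injK ll eu) (step_injK ll ev).
have [a|su] := pickP (fun a => s a == pos u); last first.
  have : spot_of u = None.
    by case e: (spot_of u) => [a|//]; have := su a; rewrite -spot_ofP e eqxx.
  move=> e; move: (eu); rewrite {1}/step_inj e => /esym/step_inj_inr[/esym].
  by auto.
rewrite -spot_ofP => /eqP ea.
have [b|sv] := pickP (fun a => s a == pos v); last first.
  have : spot_of v = None.
    by case e: (spot_of v) => [b|//]; have := sv b; rewrite -spot_ofP e eqxx.
  move=> e; move: (ev); rewrite {1}/step_inj e => /esym/step_inj_inr[/esym].
  by auto.
rewrite -spot_ofP => /eqP eb.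
have ea' : spot_of u' = Some a.
  by apply/eqP; rewrite spot_ofP pu -spot_ofP ea.
have eb' : spot_of v' = Some b.
  by apply/eqP; rewrite spot_ofP pv -spot_ofP eb.
have sab : pos a < pos b.
  apply: (increasing_inv linA incs).
  by move/eqP: ea; move/eqP: eb; rewrite !spot_ofP => /eqP-> /eqP->.
have colt (t : Sigma) : col (val t a) (val t b) = col a b.
  by case/asboolP: (valP t) => /(_ a b sab)[].
move: eu ev; rewrite /step_inj ea ea' eb eb' => -[/ffunP eu] [/ffunP ev].
case/existsP: (ll) => j /eqP lj; case/existsP: (ll') => j' /eqP lj'.
move: (eu j) (ev j) (eu j') (ev j'); rewrite !ffunE lj lj'.
case: (l' j) => [t'|-> -> //] -> ->.
by case: (l j') => [t <- <-|<- <-]; rewrite !colt.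
Qed.

Lemma step_colE l u v : line l -> pos u < pos v ->
  step_col (step_inj l u) (step_inj l v) = col u v.
Proof.
move=> ll lt; rewrite /step_col; case: pickP => [[l' [u' v']]|]; last first.
  by move/(_ (l, (u, v))); rewrite /step_edge /= ll !eqxx lt.
case/and4P=> /= ll' /eqP eu /eqP ev lt'; exact: step_col_wd eu ev _.
Qed.

Lemma step_inj_over l : line l -> @over_emb P step_picture (step_inj l).
Proof.
move=> ll; split=> [u v lt|u] /=; last exact: step_pos_inj.
by rewrite !step_pos_inj // step_colE.
Qed.

Lemma step_col_neq0 x y : step_col x y != c0 -> exists l u v,
  [/\ line l, x = step_inj l u, y = step_inj l v, pos u < pos v
    & step_col x y = col u v].
Proof.
rewrite /step_col; case: pickP => [[l [u v]]|]; last by rewrite eqxx.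
by case/and4P=> /= ll /eqP <- /eqP <- lt _; exists l, u, v.
Qed.

Lemma step_hom cX : hom P cX -> hom step_picture cX.
Proof.
move=> hP x y _ ne; have [l [u [v [ll ex ey lt eqc]]]] := step_col_neq0 ne.
move: ne; rewrite /= eqc ex ey !step_pos_inj //; exact: hP.
Qed.

(** A clique with a vertex off the words lies in the copy of [P] of a single line,
    since all edges at such a vertex come from one line.  A clique of words lies
    above the spot, and the edge-preserving projection to the base maps it
    injectively into a copy of [A]. *)
Lemma step_clique cX : hom P cX -> patterned cX s ->
  clique_below step_picture P A.
Proof.
move=> hP pats T lT cT cardT [w ew].
have cw x y : pos x < pos y -> step_col (w x) (w y) != c0.
  by move=> lt; have [_ /= ->] := ew x y lt; apply: cT.
have adj x y : x != y -> exists l u v,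
    [/\ line l, w x = step_inj l u & w y = step_inj l v].
  by move=> /(linear_lt lT)[] /cw /step_col_neq0[l [u [v []]]] *;
     exists l; [exists u, v | exists v, u].
have other (x : T) : exists y, x != y.
  apply: contrapT => /forallNP no.
  have : #|T| <= 1.
    rewrite -(card1 x); apply: subset_leq_card; apply/fintype.subsetP=> y _.
    by rewrite inE eq_sym; apply: contraT => /no.
  by rewrite leqNgt cardT.
have [[x0 [[l v0] wx0]]|noinr] := pselect (exists x z, w x = inr z).
  left; have ll : line l.
    have [y /adj[l' [u [v [ll']]]]] := other x0.
    by rewrite wx0 => /esym/step_inj_inr[<-].
  have /choice[g Hg] x : exists v, w x = step_inj l v.
    have [->|/adj[l' [u [v [_]]]]] := eqVneq x x0.
      have [y /adj[l' [u [v [ll' wu _]]]]] := other x0.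
      move: (wu); rewrite wx0 => /esym eu.
      by have [el _] := step_inj_inr eu; exists u; rewrite -eu el.
    by move=> wx /esym; rewrite wx0 => /step_inj_inr[<- _]; exists u.
  exists g => x y lt; have := ew x y lt; rewrite /= !Hg !step_pos_inj //.
  by case=> ltg; rewrite step_colE.
right; have /choice[g Hg] x : exists a, s a = step_pos (w x).
  have [y /adj[l [u [_ [ll wx _]]]]] := other x; rewrite wx step_pos_inj //.
  case e: (spot_of u) => [a|]; first by exists a; apply/eqP; rewrite -spot_ofP e.
  by case: noinr; exists x, (l, u); rewrite wx /step_inj e.
exists g => x y lt; have [/= ltw colw] := ew x y lt.
have ltg : pos (g x) < pos (g y) by apply: (increasing_inv linA incs); rewrite !Hg.
split=> //; rewrite -pats // !Hg -colw.
by apply: (@step_hom cX hP (w x) (w y) ltw); apply: cw.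
Qed.

End Step.

(** Words of copies of [A] are copies of [A] above the spot in the new picture, and
    the words on a line are the images of the copies in [P]. *)
Lemma partite_step (L : finType) (A P : picture) (s : {ffun A -> nat}) :
  ordered_by_pos A -> increasing s ->
  exists P' : picture,
   [/\ forall chi : (A -> P') -> L,
         exists2 f : P -> P', over_emb f &
           forall t t' : A -> P, lies_over s t -> lies_over s t' -> chi (f \o t) = chi (f \o t')
     , forall cX, hom P cX -> hom P' cX
     & forall cX, hom P cX -> patterned cX s -> clique_below P' P A].
Proof.
move=> linA incs.
have [I HI] := Hales_Jewett {t : {ffun A -> P} | `[< lies_over s t >]} L.
exists (step_picture P s I); split; last first.
- by move=> cX; apply: step_clique.
- by move=> cX; apply: step_hom.
move=> chi.
pose word (h : {ffun I -> {t : {ffun A -> P} | `[< lies_over s t >]}}) :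
  A -> step_picture P s I := fun a => inl [ffun j => val (h j) a].
have [l ll ml] := HI (fun h => chi (word h)).
exists (step_inj l); first exact: step_inj_over.
have wordE t (ot : lies_over s t) : exists x, step_inj l \o t = word (line_point l x).
  have ot' : `[< lies_over s [ffun a => t a] >].
    apply/asboolP; case: ot => et pt; split=> [a b|a]; last by rewrite ffunE.
    by rewrite !ffunE; apply: et.
  exists (exist _ [ffun a => t a] ot'); apply/funext => a /=.
  have -> : step_inj l (t a) = inl [ffun j => if l j is Some u then val u a else t a].
    have /eqP : spot_of s (t a) == Some a.
      by rewrite spot_ofP //; case: ot => _ ->.
    by rewrite /step_inj => ->.
  congr inl; apply/ffunP=> j; rewrite !ffunE; case: (l j) => //=.
  by rewrite ffunE.
by move=> t t' /wordE[x ->] /wordE[x' ->]; apply: ml.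
Qed.

(** A later step only shrinks to a copy of an earlier picture, so what was achieved
    for earlier spots persists. *)
Lemma partite_iterate (L : finType) (A P : picture) (ss : seq {ffun A -> nat}) :
  ordered_by_pos A -> (forall s, s \in ss -> increasing s) ->
  exists P' : picture,
   [/\ forall chi : (A -> P') -> L,
         exists2 f : P -> P', over_emb f &
           forall s, s \in ss -> forall t t' : A -> P, lies_over s t -> lies_over s t' ->
             chi (f \o t) = chi (f \o t')
     , forall cX, hom P cX -> hom P' cX
     & forall cX, hom P cX -> (forall s, s \in ss -> patterned cX s) ->
         clique_below P' P A].
Proof.
move=> linA; elim: ss => [|s ss IH] incs.
  exists P; split=> // [chi|]; first by exists id.
  by move=> cX _ _ T _ _ _; left.
have [|P1 [R1 H1 C1]] := IH.
  by move=> s' s'ss; apply: incs; rewrite inE s'ss orbT.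
have [|P2 [R2 H2 C2]] := partite_step L P1 linA (s := s).
  by apply: incs; rewrite inE eqxx.
exists P2; split; last first.
- move=> cX hP pats T lT cT cardT eT.
  have pat : patterned cX s by apply: pats; rewrite inE eqxx.
  have pats' s' : s' \in ss -> patterned cX s'.
    by move=> s'ss; apply: pats; rewrite inE s'ss orbT.
  have [e1|] := C2 cX (H1 cX hP) pat T lT cT cardT eT; last by right.
  exact: C1 cX hP pats' T lT cT cardT e1.
- by move=> cX /H1; apply: H2.
move=> chi; have [f2 [e2 p2] m2] := R2 chi.
have [f1 [e1 p1] m1] := R1 (fun t => chi (f2 \o t)).
exists (f2 \o f1).
  by split; [apply: emb_comp e1 e2 | move=> x /=; rewrite p2].
move=> s'; rewrite inE => /predU1P[->|s'ss] t t' ot ot'; last exact: m1 ot ot'.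
have o1 u : lies_over s u -> lies_over s (f1 \o u).
  by case=> eu pu; split; [apply: emb_comp eu e1 | move=> a /=; rewrite p1].
exact: m2 (o1 t ot) (o1 t' ot').
Qed.

End Pictures.

(** * Ramsey structures without new cliques *)
Section Rounds.
Variables (K : eqType) (c0 : K) (L : finType) (l0 : L).
Local Notation picture := (picture K).
Implicit Types A B P T : picture.

(** The partition relation [P -> (B)^A] for colourings of embeddings. *)
Definition arrows P B A : Prop := forall chi : (A -> P) -> L,
  exists2 f : B -> P, emb f &
    forall g g' : A -> B, emb g -> emb g' -> chi (f \o g) = chi (f \o g').

(** The same relation for a base given by lists of spots for [A] and for [B]. *)
Definition base_arrows A B (ss : seq {ffun A -> nat}) (rs : seq {ffun B -> nat}) :=
  forall xi : {ffun A -> nat} -> L,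
  exists2 r, r \in rs & forall g g' : A -> B, emb g -> emb g' ->
    [ffun a => r (g a)] \in ss /\
    xi [ffun a => r (g a)] = xi [ffun a => r (g' a)].

(** The initial picture is the disjoint union of copies of [B], one above each
    spot in [rs].  After [partite_iterate] the colour of a copy of [A] in it
    depends on the spot only, and [base_arrows] finds a spot of [B] all of whose
    spots of [A] have the same colour. *)
Lemma partite_round A B (ss : seq {ffun A -> nat}) (rs : seq {ffun B -> nat}) :
  ordered_by_pos A -> ordered_by_pos B -> (forall s, s \in ss -> increasing s) ->
  (forall r, r \in rs -> increasing r) -> base_arrows ss rs ->
  exists P, arrows P B A /\
    forall cX, (forall s, s \in ss -> patterned cX s) ->
      (forall r, r \in rs -> patterned cX r) -> clique_below c0 P B A.
Proof.
move=> linA linB incss incrs base.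
pose P0 : picture := @Picture K ('I_(size rs) * B)%type
  (fun v => tnth (in_tuple rs) v.1 v.2)
  (fun u v => if u.1 == v.1 then col u.2 v.2 else c0).
have inc i : increasing (tnth (in_tuple rs) i) by apply/incrs/mem_tnth.
have lt2 i y y' : tnth (in_tuple rs) i y < tnth (in_tuple rs) i y' -> pos y < pos y'.
  exact: (increasing_inv linB (inc i)).
have [P [RP HP CP]] := partite_iterate c0 L P0 linA incss.
exists P; split.
  move=> chi; have [f [ef pf] mf] := RP chi.
  pose xi (s : {ffun A -> nat}) : L :=
    if pselect (exists t : A -> P0, lies_over s t) is left h
    then chi (f \o projT1 (cid h)) else l0.
  have [r /seq_tnthP[i ->] Hr] := base xi.
  have ei : @emb K B P0 (fun y => (i, y)).
    by move=> y y' lt /=; split; [apply: inc | rewrite eqxx].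
  exists (fun y => f (i, y)); first exact: (emb_comp ei ef).
  have colr (g : A -> B) : emb g ->
      chi ((fun y => f (i, y)) \o g) = xi [ffun a => tnth (in_tuple rs) i (g a)].
    move=> eg; have ov : @lies_over K A P0 [ffun a => tnth (in_tuple rs) i (g a)]
        (fun a => (i, g a)).
      by split=> [|a]; [apply: emb_comp eg ei | rewrite ffunE].
    rewrite /xi; case: pselect => [h|[]]; last by exists (fun a => (i, g a)).
    by apply: mf ov _; [case: (Hr _ _ eg eg) | case: (cid h)].
  by move=> g g' eg eg'; rewrite !colr //; case: (Hr _ _ eg eg').
move=> cX patss patrs T lT cT cardT eT.
have hP0 : hom c0 P0 cX.
  move=> [i y] [j z] /=; case: (eqVneq i j) => [<-|_]; last by rewrite eqxx.
  by move=> lt _; rewrite (patrs _ (mem_tnth i (in_tuple rs))) // (lt2 i).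
have [[f ef]|] := CP cX hP0 patss T lT cT cardT eT; last by right.
left; have same x y : (f x).1 = (f y).1.
  have [->//|/(linear_lt lT)] := eqVneq x y.
  by case=> lt; have [_] := ef _ _ lt; have := cT _ _ lt; rewrite /= => /[swap] <-;
     case: (eqVneq (f _).1 _) => //; rewrite eqxx.
exists (fun x => (f x).2) => x y lt; have [/= ltf] := ef x y lt.
by rewrite (same y x) eqxx in ltf *; split=> //; apply: lt2 ltf.
Qed.

(** Ties within a part are broken arbitrarily.  This is harmless: copies of [B]
    and cliques are transversal, and the pairs that become comparable get no
    edge. *)
Definition linearize P : picture :=
  @Picture K P (fun v => pos v * #|P| + enum_rank v)
    (fun u v => if pos u < pos v then col u v else c0).

Lemma linearize_lt P (u v : P) : pos u < pos v ->
  @pos K (linearize P) u < @pos K (linearize P) v.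
Proof.
move=> lt /=; apply: (@leq_trans ((pos u).+1 * #|P|)).
  by rewrite mulSn addnC ltn_add2r.
by apply: leq_trans (leq_addr _ _); rewrite leq_mul2r lt orbT.
Qed.

Lemma linearize_linear P : ordered_by_pos (linearize P).
Proof.
move=> u v e; case: (ltngtP (@pos K P u) (@pos K P v)) => [lt|lt|eq].
- by have := linearize_lt lt; rewrite e ltnn.
- by have := linearize_lt lt; rewrite e ltnn.
by move: e; rewrite /= eq => /addnI /val_inj /enum_rank_inj.
Qed.

Lemma emb_linearize P T (f : T -> P) : emb f -> @emb K T (linearize P) f.
Proof.
by move=> ef x y /ef[lt <-]; split; [exact: linearize_lt | rewrite /= lt].
Qed.

Lemma arrows_linearize P B A : arrows P B A -> arrows (linearize P) B A.
Proof.
by move=> RP chi; have [f ef mf] := RP chi; exists f => //; apply: emb_linearize.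
Qed.

Lemma clique_below_linearize P B A :
  clique_below c0 P B A -> clique_below c0 (linearize P) B A.
Proof.
move=> CP T lT cT cardT [f ef]; apply: CP => //; exists f => x y lt.
have [_] := ef x y lt; have := cT _ _ lt; rewrite /=.
by case: ifP => // _ /[swap] <-; rewrite eqxx.
Qed.

(** With the traces of the copies of [A] and [B] in [X] as spots, every picture of
    the round projects homomorphically to [X]. *)
Lemma partite_second_round (X A B : picture) :
  ordered_by_pos X -> ordered_by_pos A -> ordered_by_pos B -> arrows X B A ->
  exists2 P, arrows P B A & clique_below c0 P B A.
Proof.
move=> linX linA linB RX.
pose trace (C : picture) (t : {ffun C -> X}) : {ffun C -> nat} := [ffun c => pos (t c)].
pose spots (C : picture) :=
  [seq trace C t | t : {ffun C -> X} <- enum {: {ffun C -> X}} & `[< emb t >]].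
have spotsP (C : picture) (s : {ffun C -> nat}) :
    s \in spots C -> exists2 t : C -> X, emb t & forall c, s c = pos (t c).
  case/mapP=> t; rewrite mem_filter => /andP[/asboolP et _] ->.
  by exists t => // c; rewrite ffunE.
have spotsI (C : picture) (t : C -> X) : emb t -> [ffun c => pos (t c)] \in spots C.
  move=> et; apply/mapP; exists [ffun c => t c].
    rewrite mem_filter mem_enum andbT; apply/asboolP=> x y.
    by rewrite !ffunE; apply: et.
  by apply/ffunP=> c; rewrite !ffunE.
have inc (C : picture) (s : {ffun C -> nat}) : s \in spots C -> increasing s.
  by case/spotsP=> t et ts x y /et[]; rewrite !ts.
pose cX p q := if [pick z : X * X | (pos z.1 == p) && (pos z.2 == q)] is Some z
  then col z.1 z.2 else c0.
have cXE (u v : X) : cX (pos u) (pos v) = col u v.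
  rewrite /cX; case: pickP => [[u' v']|/(_ (u, v))]; last by rewrite /= !eqxx.
  by case/andP=> /= /eqP/linX-> /eqP/linX->.
have pat (C : picture) (s : {ffun C -> nat}) : s \in spots C -> patterned cX s.
  by case/spotsP=> t et ts x y /et[_ <-]; rewrite !ts cXE.
have base : base_arrows (spots A) (spots B).
  move=> xi; have [f ef mf] := RX (fun t => xi [ffun a => pos (t a)]).
  exists [ffun b => pos (f b)]; first exact: spotsI.
  have E (g : A -> B) : [ffun a => [ffun b => pos (f b)] (g a)]
      = [ffun a => pos ((f \o g) a)].
    by apply/ffunP=> a; rewrite !ffunE.
  move=> g g' eg eg'; rewrite !E; split; last exact: mf.
  by apply: spotsI; exact: emb_comp eg ef.
have [P [RP CP]] := partite_round linA linB (inc A) (inc B) base.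
by exists P => //; apply: CP (pat A) (pat B).
Qed.

Definition ord_picture n (c : 'I_n -> 'I_n -> K) : picture :=
  @Picture K 'I_n (fun i => i : nat) c.

Lemma ord_picture_linear n (c : 'I_n -> 'I_n -> K) : ordered_by_pos (ord_picture c).
Proof. by move=> i j /val_inj. Qed.

(** The base is a long initial segment of the numbers with all increasing maps as
    spots, for which [base_arrows] is [finite_Ramsey]. *)
Lemma partite_first_round a b (cA : 'I_a -> 'I_a -> K) (cB : 'I_b -> 'I_b -> K) :
  exists P, arrows P (ord_picture cB) (ord_picture cA).
Proof.
set A := ord_picture cA; set B := ord_picture cB.
have [p Hp] := finite_Ramsey a b l0.
have ltn_tr : transitive ltn by move=> x y z; apply: ltn_trans.
pose spots (n : nat) : seq {ffun 'I_n -> nat} :=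
  [seq [ffun i => t i : nat] | t : {ffun 'I_n -> 'I_p} <-
    enum {: {ffun 'I_n -> 'I_p}} & [forall i : 'I_n, forall j : 'I_n, (i < j) ==> (t i < t j)]].
have spotsI n (t : {ffun 'I_n -> nat}) : (forall i, t i < p) ->
    (forall i j : 'I_n, i < j -> t i < t j) -> t \in spots n.
  move=> tp tinc; apply/mapP; exists [ffun i => Ordinal (tp i)].
    rewrite mem_filter mem_enum andbT; apply/forallP=> i; apply/forallP=> j.
    by apply/implyP=> ij; rewrite !ffunE /= tinc.
  by apply/ffunP=> i; rewrite !ffunE.
have spotsP n (t : {ffun 'I_n -> nat}) : t \in spots n ->
    forall i j : 'I_n, i < j -> t i < t j.
  case/mapP=> u; rewrite mem_filter => /andP[/forallP inc _] -> i j ij.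
  by rewrite !ffunE; move/forallP/(_ j)/implyP: (inc i); apply.
have incA s : s \in spots a -> @increasing K A s by exact: spotsP.
have incB s : s \in spots b -> @increasing K B s by exact: spotsP.
have base : @base_arrows A B (spots a) (spots b).
  move=> xi.
  have [] := Hp (iota 0 p) (iota_ltn_sorted 0 p) _ (fun Z => xi [ffun i : 'I_a => nth 0 Z i]).
    by rewrite size_iota.
  move=> Y Yp [sY [i0 Yi]].
  have sortY : sorted ltn Y by apply: subseq_sorted Yp (iota_ltn_sorted 0 p).
  have ltY (i j : 'I_b) : i < j -> nth 0 Y i < nth 0 Y j.
    by move=> ij; apply: (sorted_ltn_nth ltn_tr 0 sortY); rewrite ?inE ?sY.
  have Ylt (i : 'I_b) : nth 0 Y i < p.
    have iY : i < size Y by rewrite sY.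
    by have := mem_subseq Yp (mem_nth 0 iY); rewrite mem_iota.
  exists [ffun i : 'I_b => nth 0 Y i].
    by apply: spotsI => [i|i j ij]; rewrite !ffunE //; apply: ltY.
  have E (g : A -> B) : emb g -> [ffun x => [ffun i : 'I_b => nth 0 Y i] (g x)] \in spots a
     /\ xi [ffun x => [ffun i : 'I_b => nth 0 Y i] (g x)] = i0.
    move=> eg; have ltg (i j : 'I_a) : i < j -> nth 0 Y (g i) < nth 0 Y (g j).
      by move=> ij; apply: ltY; case: (eg i j ij).
    split; first by apply: spotsI => [i|i j ij]; rewrite !ffunE //; apply: ltg.
    pose Z := [seq nth 0 Y (g i) | i <- enum 'I_a].
    have nthZ (i : 'I_a) : nth 0 Z i = nth 0 Y (g i).
      by rewrite (nth_map i) ?size_enum_ord // nth_ord_enum.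
    have sizeZ : size Z = a by rewrite size_map size_enum_ord.
    rewrite -(Yi Z) //.
    - by congr xi; apply/ffunP=> i; rewrite !ffunE nthZ.
    - apply/(sortedP 0) => i; rewrite sizeZ => ia.
      by have := ltg (Ordinal (ltnW ia)) (Ordinal ia); rewrite -!nthZ; apply.
    - by move=> z /mapP[i _ ->]; apply: mem_nth; rewrite sY.
  by move=> g g' /E[? ->] /E[? ->].
have [P [RP _]] := partite_round (@ord_picture_linear a cA)
  (@ord_picture_linear b cB) incA incB base.
by exists P.
Qed.

Theorem clique_preserving_Ramsey a b
    (cA : 'I_a -> 'I_a -> K) (cB : 'I_b -> 'I_b -> K) :
  exists P, [/\ ordered_by_pos P, arrows P (ord_picture cB) (ord_picture cA) &
    clique_below c0 P (ord_picture cB) (ord_picture cA)].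
Proof.
have [P1 R1] := partite_first_round cA cB.
have [P2 R2 C2] := partite_second_round (@linearize_linear P1)
  (@ord_picture_linear a cA) (@ord_picture_linear b cB) (arrows_linearize R1).
exists (linearize P2); split; first exact: linearize_linear.
  exact: arrows_linearize.
exact: clique_below_linearize.
Qed.

End Rounds.

(** * Recursive functions: numbering and determinism *)

(** The generated induction principle gives no hypothesis for the functions [gs]
    in a composition. *)
Section RecfunInd.
Variable P : recfun -> Prop.
Hypotheses (hzero : P RZero) (hsucc : P RSucc) (hproj : forall i, P (RProj i)).
Hypothesis hcomp : forall f gs, P f -> List.Forall P gs -> P (RComp f gs).
Hypothesis hprim : forall f g, P f -> P g -> P (RPrim f g).
Hypothesis hmin : forall f, P f -> P (RMin f).

Fixpoint recfun_nested_ind (f : recfun) : P f :=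
  match f with
  | RZero => hzero
  | RSucc => hsucc
  | RProj i => hproj i
  | RComp f gs => hcomp (recfun_nested_ind f)
     ((fix all gs : List.Forall P gs := match gs with
       | [::] => List.Forall_nil P
       | g :: gs => List.Forall_cons g (recfun_nested_ind g) (all gs)
       end) gs)
  | RPrim f g => hprim (recfun_nested_ind f) (recfun_nested_ind g)
  | RMin f => hmin (recfun_nested_ind f)
  end.
End RecfunInd.

Fixpoint recfun_code (f : recfun) : nat :=
  match f with
  | RZero => CodeSeq.code [:: 0]
  | RSucc => CodeSeq.code [:: 1]
  | RProj i => CodeSeq.code [:: 2; i]
  | RComp f gs =>
      CodeSeq.code [:: 3, recfun_code f & [seq recfun_code g | g <- gs]]
  | RPrim f g => CodeSeq.code [:: 4; recfun_code f; recfun_code g]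
  | RMin f => CodeSeq.code [:: 5; recfun_code f]
  end.

Lemma recfun_code_inj : injective recfun_code.
Proof.
have code_inj := can_inj CodeSeq.codeK.
elim/recfun_nested_ind => [||i|f gs IHf IHgs|f g IHf IHg|f IHf]
  [||i'|f' gs'|f' g'|f'] /code_inj //.
- by case=> ->.
- case=> /IHf-> e; congr RComp; elim: IHgs gs' e => [|g hs IHg _ IH] [|g' hs'] //=.
  by case=> /IHg-> /IH->.
- by case=> /IHf-> /IHg->.
- by case=> /IHf->.
Qed.

Lemma rec_eval_fun f xs y z : rec_eval f xs y -> rec_eval f xs z -> y = z.
Proof.
elim/recfun_nested_ind: f xs y z => [||i|f gs IHf IHgs|f g IHf IHg|f IHf] xs y z.
- by move=> H H'; inversion H; inversion H'.
- by move=> H; inversion H; subst=> H'; inversion H'.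
- by move=> H H'; inversion H; inversion H'; subst.
- move=> H; inversion H as [| | |f1 gs1 xs1 ys z1 Hys Hf| | |]; subst.
  move=> H'; inversion H' as [| | |f1 gs1 xs1 ys' z1 Hys' Hf'| | |]; subst.
  suff eys : ys = ys' by apply: IHf Hf _; rewrite eys.
  clear - IHgs Hys Hys'; elim: IHgs ys ys' Hys Hys' => [|g hs IHg _ IH] ys ys' Hys Hys'.
    by inversion Hys; inversion Hys'.
  inversion Hys as [|? u ? us Hu Hus]; subst.
  inversion Hys' as [|? u' ? us' Hu' Hus']; subst.
  by rewrite (IHg _ _ _ Hu Hu') (IH _ _ Hus Hus').
- case: xs => [|n xs]; first by move=> H; inversion H.
  elim: n y z => [|n IHn] y z H H'.
    by inversion H; inversion H'; subst; apply: IHf; eauto.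
  inversion H as [| | | | |f1 g1 n1 xs1 u z1 Hu Hg|]; subst.
  inversion H' as [| | | | |f1 g1 n1 xs1 u' z1 Hu' Hg'|]; subst.
  by apply: IHg Hg _; rewrite (IHn _ _ Hu Hu').
- move=> H H'.
  inversion H as [| | | | | |f1 xs1 n1 Hlt H0]; subst.
  inversion H' as [| | | | | |f1 xs1 n1 Hlt' H0']; subst.
  case: (ltngtP y z) => // [/Hlt'|/Hlt] [k Hk].
    by have := IHf _ _ _ H0 Hk.
  by have := IHf _ _ _ H0' Hk.
Qed.

(** * The forbidden cliques *)

(** The colour of a pair [x < y] is the pair of truth values of an edge from [x]
    to [y] and of an edge from [y] to [x]. *)
Definition color := (bool * bool)%type.
Definition no_edge : color := (false, false).

(** The only double edge joins the two end points and the only backward edges join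
    neighbours.  Therefore an embedding between two patterns fixes the ends and
    respects successors. *)
Definition pattern (n i j : nat) : color :=
  if (i == 0) && (j == n.+2) then (true, true)
  else if j == i.+1 then (false, true) else (true, false).

Lemma pattern_edge n i j : (pattern n i j).1 || (pattern n i j).2.
Proof. by rewrite /pattern; case: ifP => // _; case: ifP. Qed.

(** [w] is only used on the numbers below [n + 3]. *)
Definition realizes (D : Type) (E L : D -> D -> Prop) (n : nat) (w : nat -> D) :=
  forall i j, i < j -> j < n.+3 ->
    [/\ L (w i) (w j), E (w i) (w j) <-> (pattern n i j).1
      & E (w j) (w i) <-> (pattern n i j).2].

Lemma realizes_adjacent (D : Type) (E L : D -> D -> Prop) n w i j :
  realizes E L n w -> i < n.+3 -> j < n.+3 -> i != j ->
  (E (w i) (w j) \/ E (w j) (w i)) /\ (L (w i) (w j) \/ L (w j) (w i)).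
Proof.
move=> rw im jm; wlog lt : i j im jm / i < j => [H ij|_].
  case: (ltngtP i j) (ij) => // lt _; first exact: H.
  have [] := H j i jm im lt; first by rewrite eq_sym.
  by move=> e l; split; apply/or_comm.
have [l e1 e2] := rw i j lt jm; split; last by left.
by case/orP: (pattern_edge n i j) => [/e1|/e2]; auto.
Qed.

Definition admissible (N : set nat) (D : Type) (E L : D -> D -> Prop) : Prop :=
  [/\ [/\ forall x, ~ L x x, forall x y z, L x y -> L y z -> L x z &
          forall x y, [\/ L x y, x = y | L y x]],
      forall x, ~ E x x & forall n w, N n -> ~ realizes E L n w].

(** * The generic structure *)
Section PartialIso.
Variables (D D' : eqType) (E L : D -> D -> Prop) (E' L' : D' -> D' -> Prop).

Definition piso (s : seq (D * D')) : Prop :=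
  forall p q, p \in s -> q \in s ->
    [/\ p.1 = q.1 <-> p.2 = q.2, L p.1 q.1 <-> L' p.2 q.2
      & E p.1 q.1 <-> E' p.2 q.2].

Lemma piso_realizes s n w : piso s ->
  (forall i, i < n.+3 -> w i \in unzip2 s) -> realizes E' L' n w ->
  exists v, realizes E L n v.
Proof.
move=> ps ws rw.
have /choice[v Hv] i : exists x, i < n.+3 -> (x, w i) \in s.
  have [lt|nlt] := boolP (i < n.+3).
    by case/mapP: (ws i lt) => -[x y] xys -> /=; exists x.
  by case/mapP: (ws 0 isT) => -[x y] _ _; exists x => lt; case/negP: nlt.
exists v => i j ij jn; have [lt e1 e2] := rw i j ij jn.
have vi := Hv i (ltn_trans ij jn); have vj := Hv j jn.
have [_ l1 l2] := ps _ _ vi vj; have [_ _ l3] := ps _ _ vj vi.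
by split; [apply/l1 | apply: iff_trans l2 e1 | apply: iff_trans l3 e2].
Qed.

End PartialIso.

Lemma piso_sym (D D' : eqType) (E L : D -> D -> Prop) (E' L' : D' -> D' -> Prop) s :
  piso E L E' L' s -> piso E' L' E L [seq (p.2, p.1) | p <- s].
Proof.
move=> ps _ _ /mapP[p p_s ->] /mapP[q q_s ->] /=.
by have [? ? ?] := ps p q p_s q_s; split; apply: iff_sym.
Qed.

(** The structure lives on the natural numbers.  The datum of [x] consists of its
    position in the order of the rationals and of a row, which gives for each
    [y < x] the edges from [x] to [y] and from [y] to [x].  Larger entries of a row
    are ignored, hence a structure on the numbers below [n] is determined by the
    data below [n]. *)
Definition datum := (rat * (nat -> color))%type.
Implicit Type d : nat -> datum.

Definition less_of d (x y : nat) : Prop := ((d x).1 < (d y).1)%R.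

Definition edge_of d (x y : nat) : Prop :=
  if y < x then ((d x).2 y).1 else if x < y then ((d y).2 x).2 else false.

Definition free_below (N : set nat) d n : Prop :=
  forall m w, N m -> (forall i, i < m.+3 -> w i < n) ->
    ~ realizes (edge_of d) (less_of d) m w.

Definition agree n d d' := forall x, x < n -> d x = d' x.

Lemma less_of_agree n d d' x y : agree n d d' -> x < n -> y < n ->
  less_of d x y <-> less_of d' x y.
Proof. by move=> dd' xn yn; rewrite /less_of !dd'. Qed.

Lemma edge_of_agree n d d' x y : agree n d d' -> x < n -> y < n ->
  edge_of d x y <-> edge_of d' x y.
Proof. by move=> dd' xn yn; rewrite /edge_of !dd'. Qed.

Lemma agree_sym n d d' : agree n d d' -> agree n d' d.
Proof. by move=> dd' x xn; rewrite dd'. Qed.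

Lemma realizes_agree n d d' m w : agree n d d' ->
  (forall i, i < m.+3 -> w i < n) ->
  realizes (edge_of d) (less_of d) m w -> realizes (edge_of d') (less_of d') m w.
Proof.
move=> dd' wn rw i j ij jm; have [lt e1 e2] := rw i j ij jm.
have wi := wn i (ltn_trans ij jm); have wj := wn j jm.
split; first by apply/(less_of_agree dd' wi wj).
  exact: iff_trans (edge_of_agree (agree_sym dd') wi wj) e1.
exact: iff_trans (edge_of_agree (agree_sym dd') wj wi) e2.
Qed.

Lemma free_below_agree N n d d' : agree n d d' ->
  free_below N d n -> free_below N d' n.
Proof.
move=> dd' fd m w Nm wn /(realizes_agree (agree_sym dd') wn); exact: fd.
Qed.

Definition update d n (z : datum) : nat -> datum := [eta d with n |-> z].

Lemma agree_update d n z : agree n (update d n z) d.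
Proof. by move=> x xn; rewrite /update /= ltn_eqF. Qed.

Lemma update_eq d n z : update d n z n = z.
Proof. by rewrite /update /= eqxx. Qed.

Definition fresh d n (q : rat) := forall x, x < n -> (d x).1 <> q.

Lemma fresh_between d n lo hi : (lo < hi)%R ->
  exists2 q, (lo < q < hi)%R & fresh d n q.
Proof.
elim: n lo hi => [|n IH] lo hi lt.
  by exists ((lo + hi) / 2%:R)%R => //; rewrite !midf_lt.
have [lm mh] := midf_lt lt; set m := (_ / _)%R in lm mh.
have [le|gt] := leP (d n).1 m.
  have [q /andP[mq qh] fq] := IH _ _ mh; exists q.
    by rewrite qh (lt_trans lm).
  move=> x; rewrite ltnS leq_eqVlt => /predU1P[-> e|/fq//].
  by move: mq; rewrite -e ltNge le.
have [q /andP[lq qm] fq] := IH _ _ lm; exists q.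
  by rewrite lq (lt_trans qm).
move=> x; rewrite ltnS leq_eqVlt => /predU1P[-> e|/fq//].
by move: qm; rewrite -e ltNge (ltW gt).
Qed.

(** A request asks for a new vertex between two rationals with a prescribed row,
    given as a list that is continued by [no_edge]. *)
Definition request := (rat * rat * seq color)%type.
Definition task (n : nat) : option request := unpickle (logn 2 n).

(** The numbers [2 ^ p * (2 * B + 1)] have 2-adic valuation [p]. *)
Lemma task_cofinal (r : request) B : exists2 n, B <= n & task n = Some r.
Proof.
exists (2 ^ pickle r * B.*2.+1).
  apply: (@leq_trans B.*2.+1); first by rewrite -addnn -addnS leq_addr.
  by rewrite leq_pmull // expn_gt0.
rewrite /task lognM ?expn_gt0 // pfactorK // logn_coprime ?addn0 ?pickleK //.
by rewrite coprime2n /= odd_double.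
Qed.

(** The datum [z] of the new vertex [n] creates no forbidden clique, and it obeys
    the request made at stage [n] whenever obeying is possible at every fresh
    position in the requested interval. *)
Definition grants (N : set nat) d n (z : datum) : Prop :=
  [/\ fresh d n z.1,
      free_below N d n -> free_below N (update d n z) n.+1 &
      forall lo hi l, task n = Some (lo, hi, l) -> (lo < hi)%R ->
        (forall q, (lo < q < hi)%R -> fresh d n q ->
           free_below N (update d n (q, nth no_edge l)) n.+1) ->
        (lo < z.1 < hi)%R /\ z.2 = nth no_edge l].

Lemma edge_of_row d x y : x < y -> edge_of d x y \/ edge_of d y x ->
  (d y).2 x != no_edge.
Proof.
move=> xy; rewrite /edge_of xy ltnNge (ltnW xy) /=.
by case: ((d y).2 x) => [[] []] // [].
Qed.

Lemma free_below_isolated N d n q :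
  free_below N d n -> free_below N (update d n (q, fun=> no_edge)) n.+1.
Proof.
move=> fd m w Nm wn rw.
have [wlt|/existsNP[i /not_implyP[im /negP wi]]] := pselect (forall i, i < m.+3 -> w i < n).
  exact: fd Nm wlt (realizes_agree (@agree_update d n _) wlt rw).
have {wi}wi : w i = n.
  by apply/eqP; move: (wn i im) wi; rewrite ltnS leq_eqVlt => /orP[|->].
have [j jm ij] : exists2 j, j < m.+3 & j != i.
  by case: i {wi} im => [|i] im; [exists 1 | exists 0].
have [e l] := realizes_adjacent rw jm im ij; rewrite wi in e l.
have wj : w j < n.
  move: (wn j jm); rewrite ltnS leq_eqVlt => /predU1P[wj|//].
  by move: l; rewrite wj /less_of ltxx => -[].
by have := edge_of_row wj e; rewrite update_eq eqxx.
Qed.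

Lemma grants_exists N d n : exists z, grants N d n z.
Proof.
have [[[[lo hi] l] [tn lt ok]]|none] := pselect (exists r : request,
   [/\ task n = Some r, (r.1.1 < r.1.2)%R &
     (forall q, (r.1.1 < q < r.1.2)%R -> fresh d n q ->
           free_below N (update d n (q, nth no_edge r.2)) n.+1)]).
  have [q lqh fq] := fresh_between d n lt; exists (q, nth no_edge l); split=> //.
    by move=> _; apply: ok.
  by move=> lo' hi' l'; rewrite tn => -[<- <- <-].
have [q lqh fq] := fresh_between d n (@ltr01 rat).
exists (q, fun=> no_edge); split=> //; first exact: free_below_isolated.
by move=> lo hi l tn lt ok; case: none; exists (lo, hi, l).
Qed.

Lemma grants_agree N d d' n z : agree n d d' -> grants N d n z -> grants N d' n z.
Proof.
move=> dd'; have du z' : agree n.+1 (update d n z') (update d' n z').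
  move=> x; rewrite ltnS leq_eqVlt => /predU1P[->|xn]; first by rewrite !update_eq.
  by rewrite !agree_update // dd'.
have fr q : fresh d' n q -> fresh d n q by move=> f x xn; rewrite dd' //; apply: f.
case=> f1 f2 f3; split.
- by move=> x xn; rewrite -dd' //; apply: f1.
- by move=> /(free_below_agree (agree_sym dd'))/f2; apply: free_below_agree.
move=> lo hi l tn lt ok; apply: f3 tn lt _ => q lqh fq.
apply: (free_below_agree (agree_sym (du _))); apply: ok => //.
by move=> x xn; rewrite -dd' //; apply: fq.
Qed.

(** [grants] speaks of the data below [n] only, so the data can be chosen one after
    the other. *)
Lemma generic_sequence N : exists d, forall n, grants N d n (d n).
Proof.
have /choice[F HF] : forall p : (nat -> datum) * nat, exists z, grants N p.1 p.2 z.
  by move=> p; apply: grants_exists.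
pose z0 : datum := (0%R, fun=> no_edge).
pose fix build n : nat -> datum :=
  if n is k.+1 then update (build k) k (F (build k, k)) else fun=> z0.
pose d n := build n.+1 n.
have buildE m : agree m (build m) d.
  elim: m => [//|m IH] x; rewrite ltnS leq_eqVlt => /predU1P[->//|xm].
  by rewrite -IH //= (@agree_update (build m)).
exists d => n; apply: grants_agree (buildE n) _.
by rewrite /d /= update_eq; exact: HF (build n, n).
Qed.

Lemma cut_between (l r : seq rat) : {in l & r, forall a b, (a < b)%R} ->
  exists lo hi, [/\ (lo < hi)%R, {in l, forall a, (a <= lo)%R}
    & {in r, forall b, (hi <= b)%R}].
Proof.
have bound (R : rel rat) (s : seq rat) : total R -> transitive R -> s != [::] ->
    exists2 m, m \in s & {in s, forall a, R a m}.
  move=> totR trR; elim: s => // a [|b s] IH _.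
    exists a; rewrite ?inE // => x; rewrite inE => /eqP->.
    by case/orP: (totR a a).
  have [//|m ms Hm] := IH; case/orP: (totR a m) => Ram.
    exists m; first by rewrite in_cons ms orbT.
    by move=> x; rewrite in_cons => /predU1P[->//|/Hm].
  exists a; first by rewrite in_cons eqxx.
  move=> x; rewrite in_cons => /predU1P[->|/Hm Rxm].
    by case/orP: (totR a a).
  exact: trR Rxm Ram.
have maxs (s : seq rat) : s != [::] -> exists2 m, m \in s & {in s, forall a, (a <= m)%R}.
  by apply: (bound (fun x y => (x <= y)%R)); [exact: le_total | exact: le_trans].
have mins (s : seq rat) : s != [::] -> exists2 m, m \in s & {in s, forall a, (m <= a)%R}.
  apply: (bound (fun x y => (y <= x)%R)) => [x y|y x z]; first exact: le_total.
  by move=> ? /le_trans; apply.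
have lt1 (x : rat) : (x < x + 1)%R by rewrite ltrDl ltr01.
move=> lr; have [->|/maxs[lo lol Hlo]] := eqVneq l [::].
  have [->|/mins[hi hir Hhi]] := eqVneq r [::]; first by exists 0%R, 1%R.
  by exists (hi - 1)%R, hi; split=> //; rewrite ltrBlDr.
have [->|/mins[hi hir Hhi]] := eqVneq r [::]; first by exists lo, (lo + 1)%R.
by exists lo, hi; split=> //; apply: lr.
Qed.

Section Extension.
Variables (N : set nat) (d : nat -> datum).
Hypothesis gen : forall n, grants N d n (d n).

Lemma generic_pos_inj : injective (fun x => (d x).1).
Proof.
move=> x y e; case: (ltngtP x y) => // lt; [have [f _ _] := gen y | have [f _ _] := gen x].
  by case: (f x lt).
by case: (f y lt).
Qed.

Lemma update_id n : update d n (d n) = d.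
Proof. by apply/funext => x; rewrite /update /=; case: eqP => [->|]. Qed.

Lemma generic_free n : free_below N d n.
Proof.
elim: n => [m w _ /(_ 0 isT)//|n IH].
by have [_ /(_ IH) + _] := gen n; rewrite update_id.
Qed.

Lemma generic_admissible : admissible N (edge_of d) (less_of d).
Proof.
split; first split.
- by move=> x; rewrite /less_of ltxx.
- by move=> x y z; apply: lt_trans.
- move=> x y; rewrite /less_of; case: ltgtP => [||/generic_pos_inj]; first by constructor 1.
    by constructor 3.
  by constructor 2.
- by move=> x; rewrite /edge_of ltnn.
move=> n w Nn; apply: (@generic_free (\max_(i < n.+3) w i).+1) => // i im.
by rewrite ltnS (@leq_bigmax _ (fun i : 'I__ => w i) (Ordinal im)).
Qed.

Section OnePoint.
Variables (D : eqType) (E L : D -> D -> Prop).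
Hypothesis admD : admissible N E L.
Variables (s : seq (D * nat)) (x : D).
Hypothesis xs : x \notin unzip1 s.

Definition extension_row (m : nat) : color :=
  if pselect (exists x', (x', m) \in s) is left h
  then let x' := projT1 (cid h) in (`[< E x x' >], `[< E x' x >]) else no_edge.

(** Besides [d] itself, [d'] will be a hypothetical extension of the first [n] data
    by the requested vertex. *)
Lemma one_point_piso d' n lo hi :
  (forall p, p \in s -> p.2 < n) -> piso E L (edge_of d') (less_of d') s ->
  (forall p, p \in s -> (L p.1 x -> ((d' p.2).1 <= lo)%R) /\
                        (L x p.1 -> (hi <= (d' p.2).1)%R)) ->
  (lo < (d' n).1 < hi)%R -> (d' n).2 = extension_row ->
  piso E L (edge_of d') (less_of d') ((x, n) :: s).
Proof.
move=> sn ps cut /andP[lq qh] row; case: admD => -[irrL trL totL] irrE _.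
have rowE p : p \in s -> extension_row p.2 = (`[< E x p.1 >], `[< E p.1 x >]).
  move=> p_s; rewrite /extension_row; case: pselect => [h|[]]; last first.
    by exists p.1; case: p p_s.
  have [[_ /(_ erefl) /= e] _ _] := ps _ _ (projT2 (cid h)) p_s.
  by rewrite e.
have new p : p \in s -> [/\ x <> p.1, n <> p.2,
    L x p.1 <-> less_of d' n p.2, L p.1 x <-> less_of d' p.2 n &
    (E x p.1 <-> edge_of d' n p.2) /\ (E p.1 x <-> edge_of d' p.2 n)].
  move=> p_s; have pn := sn p p_s; have [cl cr] := cut p p_s.
  have xp : x <> p.1.
    by move=> e; case/negP: xs; apply/mapP; exists p.
  have lxp : L x p.1 -> less_of d' n p.2 by move/cr; apply: lt_le_trans.
  have lpx : L p.1 x -> less_of d' p.2 n by move/cl => le; apply: le_lt_trans le _.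
  have asym u v : less_of d' u v -> less_of d' v u -> False.
    by rewrite /less_of => lt /(lt_trans lt); rewrite ltxx.
  split=> //.
  - by move=> e; rewrite -e ltnn in pn.
  - split=> // lt; case: (totL x p.1) => // /lpx /asym; exact.
  - split=> // lt; case: (totL p.1 x) => [//|/esym//|/lxp /asym].
    exact.
  - rewrite /edge_of pn ltnNge (ltnW pn) /= row rowE //=.
    by split; split=> /asboolP.
move=> p q; rewrite !inE => /predU1P[->|p_s] /predU1P[->|q_s] /=; last exact: ps.
- split=> //; split=> l; first by case: (irrL x l).
  - by move: l; rewrite /less_of ltxx.
  - by case: (irrE x l).
  - by move: l; rewrite /edge_of ltnn.
- by have [xq nq lxq lqx [e1 e2]] := new q q_s; split=> //; split.
have [xp np lxp lpx [e1 e2]] := new p p_s; split=> //.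
by split=> e; [case: xp | case: np].
Qed.

(** One-point free amalgamation.  The new vertex is requested with edges to the
    image of [s] only.  A forbidden clique through it consists of neighbours of
    it, so it lies in the image of [(x, n) :: s] and pulls back to a forbidden
    clique of [D]. *)
Lemma extension : piso E L (edge_of d) (less_of d) s ->
  exists n, piso E L (edge_of d) (less_of d) ((x, n) :: s).
Proof.
move=> ps; case: (admD) => -[irrL trL totL] irrE freeD.
have [|lo [hi [lt Hlo Hhi]]] := @cut_between
  [seq (d p.2).1 | p <- s & `[< L p.1 x >]] [seq (d p.2).1 | p <- s & `[< L x p.1 >]].
  move=> _ _ /mapP[p + ->] /mapP[q + ->]; rewrite !mem_filter.
  move=> /andP[/asboolP Lp p_s] /andP[/asboolP Lq q_s].
  by have [_ [/(_ (trL _ _ _ Lp Lq))]] := ps p q p_s q_s.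
have cut p : p \in s -> (L p.1 x -> ((d p.2).1 <= lo)%R) /\
                        (L x p.1 -> (hi <= (d p.2).1)%R).
  move=> p_s; split=> l; [apply: Hlo | apply: Hhi]; apply/mapP; exists p => //.
    by rewrite mem_filter p_s andbT; apply/asboolP.
  by rewrite mem_filter p_s andbT; apply/asboolP.
pose B := (\max_(p <- s) p.2).+1.
have sB p : p \in s -> p.2 < B by move=> p_s; rewrite ltnS; apply: leq_bigmax_seq.
have rowE : nth no_edge (mkseq extension_row B) = extension_row.
  apply/funext=> m; case: (ltnP m B) => mB; first by rewrite nth_mkseq.
  rewrite nth_default ?size_mkseq // /extension_row; case: pselect => // -[x' xm].
  by have := sB _ xm; rewrite /= ltnNge mB.
have [n Bn tn] := task_cofinal (lo, hi, mkseq extension_row B) B.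
have sn p : p \in s -> p.2 < n by move=> /sB /leq_trans; apply.
have [_ _ /(_ _ _ _ tn lt)] := gen n; rewrite rowE => grant.
have [|lqh rown] := grant; last first.
  by exists n; apply: one_point_piso lqh rown.
move=> q lqh fq; set d' := update d n _.
have dd' : agree n d d' by apply/agree_sym/agree_update.
have ps' : piso E L (edge_of d') (less_of d') ((x, n) :: s).
  have d'n : d' n = (q, extension_row) by exact: update_eq.
  apply: (@one_point_piso d' n lo hi); rewrite ?d'n //.
    move=> p p' p_s p'_s; have [e1 e2 e3] := ps p p' p_s p'_s; split=> //.
      exact: iff_trans e2 (less_of_agree dd' (sn p p_s) (sn p' p'_s)).
    exact: iff_trans e3 (edge_of_agree dd' (sn p p_s) (sn p' p'_s)).
  by move=> p p_s; rewrite -dd' ?sn //; apply: cut.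
move=> m w Nm wn rw.
have [wlt|/existsNP[i /not_implyP[im /negP wi]]] := pselect (forall i, i < m.+3 -> w i < n).
  apply: (generic_free Nm wlt); exact: realizes_agree (agree_sym dd') wlt rw.
have {wi}wi : w i = n.
  by apply/eqP; move: (wn i im) wi; rewrite ltnS leq_eqVlt => /orP[|->].
suff inside j : j < m.+3 -> w j \in unzip2 ((x, n) :: s).
  by have [v] := piso_realizes ps' inside rw; apply: freeD.
move=> jm; rewrite /= in_cons.
have [->|ij] := eqVneq j i; first by rewrite wi eqxx.
have [e l] := realizes_adjacent rw jm im ij; rewrite wi in e l.
have wj : w j < n.
  move: (wn j jm); rewrite ltnS leq_eqVlt => /predU1P[wj|//].
  by move: l; rewrite wj /less_of ltxx => -[].
have := edge_of_row wj e; rewrite /d' update_eq /= /extension_row.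
case: pselect => [[x' xw] _|]; last by rewrite eqxx.
by apply/orP; right; apply/mapP; exists (x', w j).
Qed.

End OnePoint.

Lemma extension_total (D : eqType) (E L : D -> D -> Prop) s x :
  admissible N E L -> piso E L (edge_of d) (less_of d) s ->
  exists n, piso E L (edge_of d) (less_of d) ((x, n) :: s).
Proof.
move=> adm ps; have [/mapP[p p_s ->]|xs] := boolP (x \in unzip1 s); last first.
  exact: extension.
exists p.2; case: p p_s => x' n p_s q r /=.
by rewrite !inE => /predU1P[->|q_s] /predU1P[->|r_s]; apply: ps.
Qed.

End Extension.

(** * Homogeneity and age *)
Lemma inj_surj_bijective (T U : Type) (f : T -> U) :
  injective f -> (forall y, exists x, f x = y) -> bijective f.
Proof. by move=> injf /choice[g fg]; exists g => // x; apply: injf. Qed.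

Section Copies.
Local Open Scope classical_set_scope.
Variable sigma : signature.
Implicit Types M P S : structure sigma.

Lemma map_tuple_comp n (T U V : Type) (f : T -> U) (g : U -> V) (t : n.-tuple T) :
  map_tuple g (map_tuple f t) = map_tuple (g \o f) t.
Proof. by apply: val_inj; rewrite /= -map_comp. Qed.

Lemma copyP P S (Y : set S) :
  copy P Y <-> exists2 phi : P -> S, embedding phi & range phi = Y.
Proof.
split=> [[f [[injf ef] [g fg gf]]]|[phi [injphi ephi] <-]].
  exists (fun x => val (f x)).
    by split=> [x y /val_inj/injf//|s t]; rewrite ef /= map_tuple_comp.
  apply/seteqP; split=> [_ [x _ <-]|y Yy]; first exact: set_mem (valP (f x)).
  by exists (g (exist _ y (mem_set Yy))) => //; rewrite gf.
have rphi x : phi x \in range phi by apply/mem_set; exists x.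
exists (fun x => exist _ (phi x) (rphi x)); split; first split.
- by move=> x y /(congr1 val)/injphi.
- move=> s t; rewrite ephi /= map_tuple_comp.
  by suff -> : map_tuple phi t = map_tuple (val \o (fun x => exist _ (phi x) (rphi x)
       : range phi)) t by []; apply: val_inj.
apply: inj_surj_bijective => [x y /(congr1 val)/injphi//|[y yY]].
by have [x _ xy] := set_mem yY; exists x; apply: val_inj.
Qed.

End Copies.

Definition edge (M : structure odg_signature) (x y : M) := @interp _ M Edge [tuple x; y].
Definition less (M : structure odg_signature) (x y : M) := @interp _ M Less [tuple x; y].

Definition odg (D : Type) (E L : D -> D -> Prop) : structure odg_signature :=
  @Structure odg_signature D (fun s =>
    match s return 2.-tuple D -> Prop with
    | Edge => fun t => E (tnth t ord0) (tnth t ord_max)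
    | Less => fun t => L (tnth t ord0) (tnth t ord_max)
    end).

Lemma pair_tupleE (T : Type) (t : 2.-tuple T) :
  t = [tuple tnth t ord0; tnth t ord_max].
Proof.
apply: eq_from_tnth => i; case: (unliftP ord0 i) => [j|] -> //.
by rewrite (ord1 j) (_ : lift _ _ = ord_max) //; apply: val_inj.
Qed.

Lemma map_pair_tuple (T U : Type) (f : T -> U) x y :
  map_tuple f [tuple x; y] = [tuple f x; f y].
Proof. exact: val_inj. Qed.

Lemma embedding_odg (M S : structure odg_signature) (f : M -> S) :
  embedding f <-> [/\ injective f, forall x y, edge x y <-> edge (f x) (f y)
                    & forall x y, less x y <-> less (f x) (f y)].
Proof.
split=> [[injf ef]|[injf ee el]]; split=> //.
- by move=> x y; rewrite /edge -map_pair_tuple; apply: ef.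
- by move=> x y; rewrite /less -map_pair_tuple; apply: ef.
by case=> t; rewrite (pair_tupleE t) map_pair_tuple; [apply: ee | apply: el].
Qed.

Section Generic.
Local Open Scope classical_set_scope.
Variables (N : set nat) (d : nat -> datum).
Hypothesis gen : forall n, grants N d n (d n).

Definition generic : structure odg_signature := odg (edge_of d) (less_of d).

Lemma generic_countable : countable [set: generic].
Proof. exact: (@countableP nat). Qed.

Lemma generic_infinite : infinite_set [set: generic].
Proof. exact: infinite_nat. Qed.

Lemma generic_ordered : ordered_digraph generic.
Proof. by have [[irr tr tot] _ _] := generic_admissible gen; split. Qed.

Lemma extend_all (D : eqType) (E L : D -> D -> Prop) (xs : seq D) s :
  admissible N E L -> piso E L (edge_of d) (less_of d) s ->
  exists s', [/\ piso E L (edge_of d) (less_of d) s', {subset s <= s'}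
               & {subset xs <= unzip1 s'}].
Proof.
move=> adm ps; elim: xs => [|x xs [s' [ps' ss' xss']]]; first by exists s; split=> // y; rewrite in_nil.
have [n pn] := extension_total gen x adm ps'; exists ((x, n) :: s'); split=> //.
  by move=> p /ss'; rewrite in_cons orbC => ->.
by move=> y; rewrite !in_cons => /predU1P[->|/xss' ->]; rewrite ?eqxx ?orbT.
Qed.

Lemma admissible_in_age (D : finType) (E L : D -> D -> Prop) :
  admissible N E L -> in_age generic (odg E L).
Proof.
move=> adm; split; first exact: finite_finset.
have [|s [ps _ ss]] := @extend_all D E L (enum D) [::] adm; first by move=> p q; rewrite in_nil.
have /choice[f Hf] x : exists y, (x, y) \in s.
  by have /mapP[[x' y] xy ->] := ss x (mem_enum D x); exists y.
exists f; apply/embedding_odg; split=> [x y|x y|x y].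
- by move=> exy; have [/= [_ /(_ exy)]] := ps _ _ (Hf x) (Hf y).
- by have [] := ps _ _ (Hf x) (Hf y).
- by have [] := ps _ _ (Hf x) (Hf y).
Qed.

Lemma extend_both (s : seq (nat * nat)) k :
  piso (edge_of d) (less_of d) (edge_of d) (less_of d) s ->
  exists s', [/\ piso (edge_of d) (less_of d) (edge_of d) (less_of d) s',
    {subset s <= s'}, k \in unzip1 s' & k \in unzip2 s'].
Proof.
move=> ps; have adm := generic_admissible gen.
have [n pn] := extension_total gen k adm ps.
have [m pm] := extension_total gen k adm (piso_sym pn).
exists ((m, k) :: (k, n) :: s); split.
- by move: (piso_sym pm); rewrite map_cons /= mapK // => -[].
- by move=> p ps'; rewrite !in_cons ps' !orbT.
- by rewrite /= !in_cons eqxx orbT.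
- by rewrite /= !in_cons eqxx.
Qed.

Lemma back_and_forth (s : seq (nat * nat)) :
  piso (edge_of d) (less_of d) (edge_of d) (less_of d) s ->
  exists2 g : generic -> generic, isomorphism g & forall p, p \in s -> g p.1 = p.2.
Proof.
pose ok := piso (edge_of d) (less_of d) (edge_of d) (less_of d).
move=> ps; have /choice[F HF] : forall q : {s | ok s} * nat, exists s' : {s | ok s},
    [/\ {subset sval q.1 <= sval s'}, q.2 \in unzip1 (sval s')
      & q.2 \in unzip2 (sval s')].
  move=> [[s0 ps0] k]; have [s' [ps' ss' k1 k2]] := extend_both k ps0.
  by exists (exist _ s' ps').
pose fix S n : {s | ok s} := if n is k.+1 then F (S k, k) else exist _ s ps.
have S1 n : {subset sval (S n) <= sval (S n.+1)} by case: (HF (S n, n)).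
have mon m n : m <= n -> {subset sval (S m) <= sval (S n)}.
  move=> /subnK <-; elim: (n - m) => [//|k IH] p /IH; exact: S1.
have both m n p q : p \in sval (S m) -> q \in sval (S n) ->
    [/\ p.1 = q.1 <-> p.2 = q.2, less_of d p.1 q.1 <-> less_of d p.2 q.2
      & edge_of d p.1 q.1 <-> edge_of d p.2 q.2].
  move=> /(mon _ _ (leq_maxl m n)) pS /(mon _ _ (leq_maxr m n)) qS.
  exact: (proj2_sig (S (maxn m n))).
have /choice[g Hg] x : exists y, (x, y) \in sval (S x.+1).
  by have [_ /mapP[[x' y] xy /= ex] _] := HF (S x, x); exists y; rewrite [X in (X, _)]ex.
exists g; last first.
  by move=> [x y] xys; have [[/(_ erefl)]] := both _ 0 _ _ (Hg x) xys.
split.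
  apply/embedding_odg; split=> [x y exy|x y|x y].
  - by have [[_ /(_ exy)]] := both _ _ _ _ (Hg x) (Hg y).
  - by have [] := both _ _ _ _ (Hg x) (Hg y).
  - by have [] := both _ _ _ _ (Hg x) (Hg y).
apply: inj_surj_bijective => [x y exy|y].
  by have [[_ /(_ exy)]] := both _ _ _ _ (Hg x) (Hg y).
have [_ _ /mapP[[x y'] xy /= ->]] := HF (S y, y); exists x.
by have [[/(_ erefl)]] := both _ y.+1 _ _ (Hg x) xy.
Qed.

Lemma generic_homogeneous : homogeneous generic.
Proof.
move=> X Y f /(@finite_seqP nat)[sX eX] _ [/embedding_odg[injf ef lf] _].
pose f' (x : nat) : nat :=
  if pselect (x \in X) is left h then val (f (exist _ x h)) else 0.
have inX (x : nat) : x \in sX -> x \in X by move=> xs; rewrite eX; apply/mem_set.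
have f'E (x : induced X) : f' (val x) = val (f x).
  rewrite /f'; case: pselect => [h|[]]; last exact: valP.
  by congr (val (f _)); apply: val_inj.
have [|g isog gf] := @back_and_forth [seq (x, f' x) | x <- sX].
  move=> _ _ /mapP[x /inX xX ->] /mapP[y /inX yX ->] /=.
  pose x' : induced X := exist _ x xX; pose y' : induced X := exist _ y yX.
  have -> : f' x = val (f x') by rewrite -f'E.
  have -> : f' y = val (f y') by rewrite -f'E.
  split; [split=> [exy|/val_inj/injf/(congr1 val)//]| |].
  - by congr (val (f _)); apply: val_inj.
  - exact: (lf x' y').
  - exact: (ef x' y').
exists g => // x; rewrite -f'E.
have /gf : (val x, f' (val x)) \in [seq (x, f' x) | x <- sX].
  apply/mapP; exists (val x) => //.
  by have := set_mem (valP x); rewrite {1}eX.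
by [].
Qed.

(** The enumeration sorts the image of an embedding by position. *)
Lemma age_enumeration (C : structure odg_signature) : in_age generic C ->
  exists n (h : 'I_n -> C), bijective h /\ forall i j, less (h i) (h j) <-> i < j.
Proof.
move=> [finC [f ef]]; have /embedding_odg[injf _ lf] := ef.
have /(@finite_seqP nat)[s0 es0] := finite_image f finC.
pose R := relpre (fun x => (d x).1) <=%O.
have totR : total R by move=> x y; apply: le_total.
have trR : transitive R by move=> x y z; apply: le_trans.
pose s := sort R (undup s0).
have us : uniq s by rewrite sort_uniq undup_uniq.
have sortS : sorted R s by apply: sort_sorted.
have ins (x : nat) : x \in s <-> exists c, f c = x.
  rewrite mem_sort mem_undup; have -> : (x \in s0) = `[< [set` s0] x >].
    by rewrite /= asboolb.
  rewrite -es0; split=> [/asboolP[c _ <-]|[c <-]]; first by exists c.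
  by apply/asboolP; exists c.
have /choice[h Hh] (i : 'I_(size s)) : exists c, f c = nth 0 s i.
  by apply/ins/mem_nth.
exists (size s), h; split.
  apply: inj_surj_bijective => [i j hij|c].
    have /eqP := Hh i; rewrite hij Hh nth_uniq // => /eqP ji.
    exact/esym/val_inj.
  have /(nthP 0)[i il ei] : f c \in s by apply/ins; exists c.
  by exists (Ordinal il); apply: injf; rewrite Hh.
have lth (i j : 'I_(size s)) : i < j -> less (h i) (h j).
  move=> ij; apply/lf; rewrite !Hh.
  change (less_of d (nth 0 s i) (nth 0 s j)); rewrite /less_of lt_neqAle.
  have Rij : R (nth 0 s i) (nth 0 s j).
    by apply: (sorted_ltn_nth trR 0 sortS) => //; rewrite inE.
  rewrite [X in _ && X]Rij andbT; apply/eqP => /(generic_pos_inj gen) e.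
  have := nth_uniq 0 (ltn_ord i) (ltn_ord j) us.
  by rewrite e eqxx => /esym/eqP eij; rewrite eij ltnn in ij.
move=> i j; split=> [|/lth//] lij; have [irr tr _] := generic_ordered.
have {}lij : less (f (h i)) (f (h j)) by apply/lf.
case: (ltngtP i j) => // [/lth/lf|/val_inj eij].
  by move=> lji; case: (irr _ (tr _ _ _ lij lji)).
by case: (irr (f (h i))); move: lij; rewrite -eij.
Qed.

End Generic.

(** * The Ramsey property of the generic structure *)
Section GenericRamsey.
Local Open Scope classical_set_scope.
Variables (N : set nat) (d : nat -> datum).
Hypothesis gen : forall n, grants N d n (d n).

Definition structure_color (C : structure odg_signature) n (h : 'I_n -> C)
    (i j : 'I_n) : color := (`[< edge (h i) (h j) >], `[< edge (h j) (h i) >]).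

Definition picture_edge (P : picture color) (x y : P) : Prop :=
  pos x < pos y /\ (col x y).1 \/ pos y < pos x /\ (col y x).2.

Definition picture_odg (P : picture color) : structure odg_signature :=
  odg (@picture_edge P) (fun x y => pos x < pos y).

Lemma picture_edge_lt (P : picture color) (x y : P) : pos x < pos y ->
  (picture_edge x y <-> (col x y).1) /\ (picture_edge y x <-> (col x y).2).
Proof.
move=> lt; rewrite /picture_edge lt ltnNge (ltnW lt) /=.
by split; split=> [[[]|[]]|]; auto.
Qed.

Lemma pattern_free (C : structure odg_signature) n (h : 'I_n -> C) m :
  in_age (generic d) C -> (forall i j, less (h i) (h j) <-> i < j) -> N m ->
  ~ exists f : 'I_m.+3 -> 'I_n, @emb color
      (ord_picture (fun i j : 'I_m.+3 => pattern m i j))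
      (ord_picture (structure_color h)) f.
Proof.
move=> [_ [phi /embedding_odg[_ ephi lphi]]] lh Nm [f ef].
have [_ _ free] := generic_admissible gen.
apply: (free m (fun k => phi (h (f (inord k)))) Nm) => i j ij jm.
have [|ltf colf] := ef (inord i) (inord j).
  by rewrite /= !inordK // (ltn_trans ij).
rewrite /= /structure_color !inordK // in colf; last exact: ltn_trans jm.
rewrite -colf; split.
- exact/(lphi (h _) (h _))/lh.
- by split=> [/(ephi (h _) (h _)) e|/asboolP/ephi]; first exact/asboolP.
- by split=> [/(ephi (h _) (h _)) e|/asboolP/ephi]; first exact/asboolP.
Qed.

Lemma picture_admissible (P : picture color) : ordered_by_pos P ->
  (forall m, N m -> ~ exists f : 'I_m.+3 -> P, @emb color
      (ord_picture (fun i j : 'I_m.+3 => pattern m i j)) P f) ->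
  admissible N (@picture_edge P) (fun x y => pos x < pos y).
Proof.
move=> linP free; split; first split.
- by move=> x; rewrite ltnn.
- by move=> x y z; apply: ltn_trans.
- move=> x y; case: (ltngtP (pos x) (pos y)) => [||/linP].
  + by constructor 1.
  + by constructor 3.
  + by constructor 2.
- by move=> x [] []; rewrite ltnn.
move=> m w Nm rw; apply: (free m Nm); exists (fun i => w i) => i j ij.
have [lt e1 e2] := rw i j ij (ltn_ord j); split=> //.
have [f1 f2] := picture_edge_lt lt; rewrite /=.
have b1 : (col (w i) (w j)).1 = (pattern m i j).1.
  by apply/idP/idP => [/f1/e1|/e1/f1].
have b2 : (col (w i) (w j)).2 = (pattern m i j).2.
  by apply/idP/idP => [/f2/e2|/e2/f2].
by rewrite [LHS]surjective_pairing [RHS]surjective_pairing b1 b2.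
Qed.

Lemma emb_odg (C : structure odg_signature) n (h : 'I_n -> C) (P : picture color)
    (f : 'I_n -> P) (h' : C -> 'I_n) :
  ordered_by_pos P -> ordered_digraph C -> (forall x, ~ @edge C x x) ->
  cancel h h' -> cancel h' h ->
  (forall i j, less (h i) (h j) <-> i < j) ->
  @emb color (ord_picture (structure_color h)) P f ->
  @embedding _ C (picture_odg P) (f \o h').
Proof.
move=> linP ordC irrE hK h'K lh ef.
have injf : injective f.
  move=> i j eij; apply/val_inj; case: (ltngtP i j) => // /ef[];
  by rewrite eij ltnn.
have ltf i j : pos (f i) < pos (f j) -> i < j.
  case: (ltngtP i j) => // [/ef[]|/val_inj->]; last by rewrite ltnn.
  by move=> lt _; rewrite ltnNge (ltnW lt).
apply/embedding_odg; split.
- by apply: inj_comp injf (can_inj h'K).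
- move=> x y; rewrite -{1}(h'K x) -{1}(h'K y).
  change (edge (h (h' x)) (h (h' y)) <-> picture_edge (f (h' x)) (f (h' y))).
  case: (ltngtP (h' x) (h' y)) => [lt|lt|/val_inj->].
  + have [ltp colp] := ef _ _ lt; have [-> _] := picture_edge_lt ltp.
    by rewrite colp; split=> /asboolP.
  + have [ltp colp] := ef _ _ lt; have [_ ->] := picture_edge_lt ltp.
    by rewrite colp; split=> /asboolP.
  split=> [/irrE//|[] []]; by rewrite ltnn.
move=> x y; rewrite -{1}(h'K x) -{1}(h'K y).
apply: iff_trans (lh _ _) _; split=> [/ef[]//|]; exact: ltf.
Qed.

(** The Ramsey picture for the enumerated structures has no forbidden clique, since
    such a clique would embed into [H] or [P].  A set of vertices is coloured
    through the embeddings that have it as range; as the structures are ordered,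
    copies and embeddings amount to the same. *)
Lemma generic_ramsey : ramsey (generic d).
Proof.
move=> k H P k0 ageH ageP.
have [a [hA [[hA' hAK hA'K] lA]]] := age_enumeration gen ageP.
have [b [hB [[hB' hBK hB'K] lB]]] := age_enumeration gen ageH.
have [Q [linQ arrQ cliqueQ]] := clique_preserving_Ramsey no_edge (Ordinal k0)
  (structure_color hA) (structure_color hB).
exists (picture_odg Q).
  apply: (@admissible_in_age N d gen (vertex Q)).
  apply: picture_admissible => // m Nm eQ.
  have [||||] := cliqueQ (ord_picture (fun i j : 'I_m.+3 => pattern m i j)) _ _ _ eQ.
  - exact: ord_picture_linear.
  - move=> i j _ /=; case: (pattern m i j) (pattern_edge m i j) => -[] [] //.
  - by rewrite card_ord.
  - exact: pattern_free ageH lB Nm.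
  - exact: pattern_free ageP lA Nm.
move=> chi; have [f ef mf] := arrQ (fun t => chi (range t)).
have [ordH irrH] : ordered_digraph H /\ forall x : H, ~ edge x x.
  have [_ [phi /embedding_odg[injphi ephi lphi]]] := ageH.
  have [[irr tr tot] irrE _] := generic_admissible gen; split; last first.
    by move=> x /ephi; apply: irrE.
  split.
  - by move=> x /lphi; apply: irr.
  - by move=> x y z /lphi lxy /lphi lyz; apply/lphi; apply: tr lxy lyz.
  move=> x y; case: (tot (phi x) (phi y)) => [/lphi|/injphi|/lphi].
  - by constructor 1.
  - by constructor 2.
  - by constructor 3.
exists (range f).
  apply/copyP; exists (f \o hB').
    exact: emb_odg linQ ordH irrH hBK hB'K lB ef.
  apply/seteqP; split=> [_ [x _ <-]|_ [i _ <-]]; first by exists (hB' x).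
  by exists (hB i) => //=; rewrite hBK.
pose A := ord_picture (structure_color hA).
pose B := ord_picture (structure_color hB).
have key Y : @copy _ P (picture_odg Q) Y -> Y `<=` range f ->
    exists2 g : A -> B, emb g & Y = range (f \o g).
  move=> /copyP[phi /embedding_odg[injphi ephi lphi] <-] sub.
  have /choice[g Hg] (i : 'I_a) : exists j, f j = phi (hA i).
    by have [|j _ fj] := sub (phi (hA i)); [exists (hA i) | exists j].
  have ltf := increasing_inv (@ord_picture_linear _ b (structure_color hB))
    (fun x y xy => (ef x y xy).1).
  exists g; last first.
    apply/seteqP; split=> [_ [x _ <-]|_ [i _ <-]].
      by exists (hA' x) => //=; rewrite Hg hA'K.
    by exists (hA i) => //=; rewrite Hg.
  move=> i j ij; have lij : pos (phi (hA i)) < pos (phi (hA j)).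
    by apply/(lphi (hA i) (hA j))/lA.
  have gij : g i < g j by apply: ltf; rewrite !Hg.
  split=> //; have [_ <-] := ef _ _ gij; rewrite !Hg.
  have [e1 e2] := picture_edge_lt lij.
  rewrite [LHS]surjective_pairing; congr pair.
    by apply/idP/asboolP => [/e1/(ephi (hA i) (hA j))|/(ephi (hA i) (hA j))/e1].
  by apply/idP/asboolP => [/e2/(ephi (hA j) (hA i))|/(ephi (hA j) (hA i))/e2].
have [[g0 eg0]|none] := pselect (exists g : A -> B, emb g).
  exists (chi (range (f \o g0))) => Y cY /(key Y cY)[g eg ->].
  exact: mf.
exists (Ordinal k0) => Y cY /(key Y cY)[g eg _].
by case: none; exists g.
Qed.

End GenericRamsey.

(** * Formulas and the reduction *)
Lemma pattern_rigid n m (f : 'I_n.+3 -> 'I_m.+3) :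
  @emb color (ord_picture (fun i j : 'I_n.+3 => pattern n i j))
    (ord_picture (fun i j : 'I_m.+3 => pattern m i j)) f -> n = m.
Proof.
move=> ef.
have ends i j : pattern m i j = (true, true) -> i = 0 /\ j = m.+2.
  by rewrite /pattern; case: andP => [[/eqP-> /eqP->]//|_]; case: ifP.
have consec i j : pattern m i j = (false, true) -> j = i.+1.
  by rewrite /pattern; case: andP => // _; case: eqP.
have col_f i j : i < j -> j < n.+3 ->
    pattern m (f (inord i)) (f (inord j)) = pattern n i j.
  move=> ij jn; have [|_] := ef (inord i) (inord j).
    by rewrite /= !inordK // (ltn_trans ij).
  by rewrite /= !inordK // (ltn_trans ij).
have [|f0 fl] := ends (f (inord 0)) (f (inord n.+2)).
  by rewrite col_f // /pattern !eqxx.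
have fid i : i < n.+3 -> f (inord i) = i :> nat.
  elim: i => [//|i IH] lt; rewrite -[in RHS](IH (ltnW lt)).
  apply: consec; rewrite col_f // /pattern eqxx eqSS.
  by case: i lt {IH}.
by move: fl; rewrite fid // => -[].
Qed.

Section Formulas.
Variable sigma : signature.
Implicit Types (A : structure sigma) (phi : formula sigma).

Lemma sat_agree A (e e' : nat -> A) phi : quantifier_free phi ->
  {in free_vars phi, e =1 e'} -> sat e phi <-> sat e' phi.
Proof.
elim: phi => [s xs _ ee|x y _ ee|p IHp /IHp IH /IH|p IHp q IHq|p IHp q IHq|//|//] /=.
- suff -> : map_tuple e xs = map_tuple e' xs by [].
  by apply: val_inj; apply/eq_in_map.
- by rewrite !ee // !inE eqxx ?orbT.
- by move=> IH1; split=> np /IH1.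
- move=> /andP[/IHp{}IHp /IHq{}IHq] ee.
  have [|p1 p2] := IHp; first by move=> x xp; rewrite ee // mem_cat xp.
  have [|q1 q2] := IHq; first by move=> x xq; rewrite ee // mem_cat xq orbT.
  by split=> -[]; auto.
- move=> /andP[/IHp{}IHp /IHq{}IHq] ee.
  have [|p1 p2] := IHp; first by move=> x xp; rewrite ee // mem_cat xp.
  have [|q1 q2] := IHq; first by move=> x xq; rewrite ee // mem_cat xq orbT.
  by split=> -[]; auto.
Qed.

Lemma relation_ofE A (r : qf_def sigma) (e : nat -> A) (t : (size (qf_vars r)).-tuple A) :
  [seq e x | x <- qf_vars r] = t -> relation_of t <-> sat e (qf_body r).
Proof.
move=> et; case: r t et => vs body /= h t et; have /and3P[_ qb /allP fv] := h.
split=> [[e' e't]|]; last by exists e.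
suff : {in free_vars body, e' =1 e} by move=> /(sat_agree qb)[+ _]; apply.
by have /eq_in_map e'e : map e' vs = map e vs; [rewrite e't et|move=> x /fv/e'e].
Qed.

Lemma sat_exists_block A (e : nat -> A) ys phi :
  sat e (exists_block ys phi) <->
  exists2 e' : nat -> A, (forall x, x \notin ys -> e' x = e x) & sat e' phi.
Proof.
elim: ys e => [|y ys IH] e /=.
  split=> [|[e' ee']]; first by exists e.
  by have -> : e' = e by apply/funext=> x; apply: ee'.
split=> [[a /IH[e' ee' se']]|[e' ee' se']].
  exists e' => // x; rewrite inE negb_or => /andP[xy xys].
  by rewrite ee' //= (negPf xy).
exists (e' y); apply/IH; exists e' => // x xys /=.
by case: eqP => [->//|/eqP xy]; rewrite ee' // inE negb_or xy.
Qed.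

Lemma free_vars_exists_block ys phi x :
  (x \in free_vars (exists_block ys phi)) = (x \in free_vars phi) && (x \notin ys).
Proof.
elim: ys => [|y ys IH] /=; first by rewrite andbT.
by rewrite mem_filter IH inE negb_or andbCA.
Qed.

Lemma sat_conj A (e : nat -> A) (T : eqType) (F : T -> formula sigma) phi (ps : seq T) :
  sat e (foldr (@FAnd sigma) phi [seq F p | p <- ps]) <->
  sat e phi /\ {in ps, forall p, sat e (F p)}.
Proof.
elim: ps => [|p ps IH] /=; first by split=> [|[]].
split=> [[sp /IH[sphi sps]]|[sphi sps]].
  by split=> // q; rewrite inE => /predU1P[->|/sps].
split; first by apply: sps; rewrite inE eqxx.
by apply/IH; split=> // q qps; apply: sps; rewrite inE qps orbT.
Qed.

(** Over empty relations only equality is left, which every bijection preserves. *)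
Lemma sat_bijective A (g : A -> A) (e : nat -> A) phi : bijective g ->
  (forall s (t : (arity s).-tuple A), ~ interp t) ->
  sat e phi <-> sat (g \o e) phi.
Proof.
move=> [g' gK g'K] empty.
have upd x a (e' : nat -> A) :
    g \o [eta e' with x |-> a] = [eta (g \o e') with x |-> g a].
  by apply/funext=> y /=; case: eqP.
elim: phi e => [s xs|x y|p IHp|p IHp q IHq|p IHp q IHq|x p IHp|x p IHp] e /=.
- by split=> h; case: (empty _ _ h).
- by split=> [->|/(can_inj gK)].
- by have [h1 h2] := IHp e; split=> np sp; apply: np; auto.
- by have [? ?] := IHp e; have [? ?] := IHq e; split=> -[]; auto.
- by have [? ?] := IHp e; have [? ?] := IHq e; split=> -[]; auto.
- split=> [[a /IHp]|[a sa]]; first by rewrite upd; exists (g a).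
  by exists (g' a); apply/IHp; rewrite upd g'K.
- split=> sp a; last by apply: (iffRL (IHp _)); rewrite upd; apply: sp.
  by rewrite -(g'K a) -upd; apply: (iffLR (IHp _)); apply: sp.
Qed.

End Formulas.

Definition less_atom (x y : nat) : formula odg_signature :=
  @FAtom odg_signature Less [tuple x; y].
Definition edge_atom (x y : nat) : formula odg_signature :=
  @FAtom odg_signature Edge [tuple x; y].
Definition literal (b : bool) (phi : formula odg_signature) :=
  if b then phi else FNot phi.

(** The variables 0 and 1 are reserved for the guard [x < y], so the [i]-th vertex
    of the pattern is the variable [i + 2]. *)
Definition pair_formula (n : nat) (p : nat * nat) : formula odg_signature :=
  let x := p.1.+2 in let y := p.2.+2 in
  FAnd (less_atom x y)
    (FAnd (literal (pattern n p.1 p.2).1 (edge_atom x y))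
          (literal (pattern n p.1 p.2).2 (edge_atom y x))).

Definition pairs (n : nat) : seq (nat * nat) :=
  [seq p <- [seq (i, j) | i <- iota 0 n.+3, j <- iota 0 n.+3] | p.1 < p.2].

Definition guarded_body (n : nat) : formula odg_signature :=
  foldr (@FAnd odg_signature) (less_atom 0 1) [seq pair_formula n p | p <- pairs n].

Lemma mem_pairs n i j : ((i, j) \in pairs n) = (i < j < n.+3).
Proof.
have: forall k, (k \in iota 0 n.+3) = (k < n.+3) by move=> k; rewrite mem_iota.
rewrite /pairs; move: (iota 0 n.+3) => s sE.
rewrite mem_filter /=; case: (ltnP i j) => //= ij.
apply/allpairsP/idP => [[[i' j'] [_ /= + [_ ->]]]|jn]; first by rewrite sE.
by exists (i, j); rewrite /= !sE jn (ltn_trans ij jn).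
Qed.

Lemma guarded_bodyP n : [&& uniq (iota 0 n.+3.+2), quantifier_free (guarded_body n)
  & all (mem (iota 0 n.+3.+2)) (free_vars (guarded_body n))].
Proof.
have qf b phi : quantifier_free (literal b phi) = quantifier_free phi by case: b.
have fv b phi : free_vars (literal b phi) = free_vars phi by case: b.
rewrite iota_uniq andTb; have : forall k, (k \in iota 0 n.+3.+2) = (k < n.+3.+2).
  by move=> k; rewrite mem_iota.
have : all (fun p => (p.1 < p.2) && (p.2 < n.+3)) (pairs n).
  by apply/allP=> -[i j]; rewrite mem_pairs.
rewrite /guarded_body; move: (iota 0 _) => V; elim: (pairs n) => [|[i j] ps IH] /=.
  by move=> _ VE; rewrite !VE.
move=> /andP[/andP[ij jn] /IH{}IH] VE; have /andP[-> H] := IH VE.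
have jV : j.+2 \in V by rewrite VE.
have iV : i.+2 \in V by rewrite VE !ltnS ltnW // (leq_trans ij).
by rewrite !qf !fv /= H iV jV.
Qed.

Lemma guarded_body_sat (A : structure odg_signature) n (e : nat -> A) :
  sat e (guarded_body n) <->
  less (e 0) (e 1) /\ realizes (@edge A) (@less A) n (fun i => e i.+2).
Proof.
have lit b phi (Q : Prop) : (sat e phi <-> Q) -> sat e (literal b phi) <-> (Q <-> b).
  move=> /propext; case: b => /= [->|<-].
    by split=> [q|[_ q]]; [split | apply: q].
  by split=> [nq|[q _]]; [split=> // /nq | move=> /q].
have latom x y : sat e (less_atom x y) <-> less (e x) (e y).
  by rewrite /= map_pair_tuple.
have eatom x y : sat e (edge_atom x y) <-> edge (e x) (e y).
  by rewrite /= map_pair_tuple.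
apply: iff_trans (sat_conj _ _ _ _) _; split=> -[l H]; split; try exact/latom.
  move=> i j ij jn; have [|/latom l1 [h1 h2]] := H (i, j); first by rewrite mem_pairs ij.
  by split=> //; [move/lit: h1 => /(_ _ (eatom _ _)) | move/lit: h2 => /(_ _ (eatom _ _))].
move=> [i j]; rewrite mem_pairs => /andP[ij jn]; have [l1 h1 h2] := H i j ij jn.
split; first exact/latom.
by split; [apply/(lit _ _ _ (eatom _ _)) | apply/(lit _ _ _ (eatom _ _))].
Qed.

Definition less_def : qf_def odg_signature :=
  @QfDef odg_signature [:: 0; 1] (less_atom 0 1) isT.

Definition guarded_def (n : nat) : qf_def odg_signature :=
  QfDef (guarded_bodyP n).

Definition pattern_instance (n : nat) : expr_instance odg_signature :=
  (less_def, [:: guarded_def n]).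

Section Reduction.
Variables (N : set nat) (d : nat -> datum) (n : nat).
Hypothesis gen : forall n, grants N d n (d n).
Let ds := (pattern_instance n).2.
Let Delta := generic d.
Let realized := exists w, realizes (edge_of d) (less_of d) n w.

Lemma realizedP : realized <-> ~ N n.
Proof.
split=> [[w rw] Nn|nN]; first by have [_ _ /(_ n w Nn)] := generic_admissible gen.
have [|_ [f /embedding_odg[_ ef lf]]] := admissible_in_age gen
  (D := 'I_n.+3) (E := @picture_edge (ord_picture (fun i j : 'I_n.+3 => pattern n i j)))
  (L := fun i j => i < j).
  apply: (picture_admissible (@ord_picture_linear _ _ _)) => m Nm [f ef].
  by apply: nN; rewrite -(pattern_rigid ef).
exists (fun i => f (inord i)) => i j ij jn.
have lij : (inord i : 'I_n.+3) < (inord j : 'I_n.+3).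
  by rewrite !inordK // (ltn_trans ij).
have [e1 e2] := @picture_edge_lt (ord_picture (fun i j : 'I_n.+3 => pattern n i j))
  (inord i) (inord j) lij.
rewrite /= !inordK ?(ltn_trans ij jn) // in e1 e2; split.
- exact/(lf (inord i) (inord j)).
- exact: iff_trans (iff_sym (ef (inord i) (inord j))) e1.
- exact: iff_trans (iff_sym (ef (inord j) (inord i))) e2.
Qed.

Let s0 : def_signature ds := ord0 : 'I_1.
Let target : formula (def_signature ds) :=
  exists_block (iota 2 n.+3)
    (@FAtom (def_signature ds) s0 (in_tuple (qf_vars (tnth (in_tuple ds) s0)))).

Lemma realized_defines : realized ->
  @defines _ (def_structure Delta ds) target _ (@relation_of odg_signature Delta less_def).
Proof.
move=> [w rw]; exists [tuple 0; 1]; split=> // [x|e].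
  rewrite free_vars_exists_block => /andP[].
  have -> : free_vars (@FAtom (def_signature ds) s0
    (in_tuple (qf_vars (tnth (in_tuple ds) s0)))) = iota 0 n.+3.+2 by [].
  by rewrite !mem_iota /= !inE add2n; case: x => [|[|x]] //= ->.
apply: iff_trans (sat_exists_block _ _ _) _.
have body (e' : nat -> Delta) : sat (A := def_structure Delta ds) e'
    (@FAtom (def_signature ds) s0 (in_tuple (qf_vars (tnth (in_tuple ds) s0)))) <->
    less (e' 0) (e' 1) /\ realizes (edge_of d) (less_of d) n (fun i => e' i.+2).
  have h : sat (A := Delta) e' (guarded_body n) <-> less (e' 0 : Delta) (e' 1) /\
      realizes (edge_of d) (less_of d) n (fun i => e' i.+2) by exact: guarded_body_sat.
  apply: iff_trans h.
  exact: (relation_ofE (r := guarded_def n) (e := e')).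
have goal0 : relation_of (A := Delta) (d := less_def) (map_tuple e [tuple 0; 1]) <->
    less (e 0 : Delta) (e 1).
  apply: iff_trans (relation_ofE (r := less_def) (e := e) _) _ => //.
apply: iff_trans (iff_sym goal0); split.
  by move=> [e' ee' /body[]]; rewrite !ee' // mem_iota.
move=> l; exists (fun i => if i is k.+2 then (if k < n.+3 then w k else e i) else e i).
  move=> [|[|k]] //; rewrite mem_iota => nk.
  by suff -> : (k < n.+3) = false by []; apply: contraNF nk.
apply/body; split=> // i j ij jn; rewrite jn (ltn_trans ij jn); exact: rw.
Qed.

(** If the pattern does not embed, then the second relation is empty.  Swapping two
    points [u < v] then preserves the formula but not the order. *)
Lemma defines_realized (phi : formula (def_signature ds)) :
  @defines _ (def_structure Delta ds) phi _ (@relation_of odg_signature Delta less_def) ->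
  realized.
Proof.
move=> [xs [uxs _ def]]; apply: contrapT => nr.
have empty (s : def_signature ds) (t : (arity s).-tuple (def_structure Delta ds)) :
    ~ interp t.
  rewrite (_ : s = s0) in t *; last exact: ord1.
  move=> [e _ /guarded_body_sat[_ re]]; apply: nr.
  by exists (fun i => e i.+2).
have [irr tr tot] := generic_ordered gen.
have [u [v luv]] : exists u v : Delta, less u v.
  by case: (tot 0 1) => // l; [exists 0, 1 | exists 1, 0].
have [x [y exs]] : exists x y, (xs : 2.-tuple nat) = [tuple x; y].
  by exists (tnth (xs : 2.-tuple nat) ord0), (tnth (xs : 2.-tuple nat) ord_max);
     exact: pair_tupleE.
have xy : x != y.
  by have := uxs; rewrite [tval xs](congr1 val exs) /= andbT mem_seq1.
pose e (z : nat) : Delta := if z == x then u else v.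
pose g (z : Delta) : Delta := if z == u :> nat then v else if z == v :> nat then u else z.
have uv : u != v :> nat by apply/eqP => uv; apply: (irr u); have := luv; rewrite -uv.
have gu : g u = v by rewrite /g eqxx.
have gv : g v = u by rewrite /g eq_sym (negPf uv) eqxx.
have bijg : bijective g.
  exists g => z; rewrite {2}/g; (case: eqP => [->|/eqP zu]; first exact: gv);
    (case: eqP => [->|/eqP zv]; first exact: gu);
    by rewrite /g (negPf zu) (negPf zv).
have ex : e x = u by rewrite /e eqxx.
have ey : e y = v by rewrite /e eq_sym (negPf xy).
have target_less (e' : nat -> Delta) : sat (A := def_structure Delta ds) e' phi <->
    less (e' x) (e' y).
  apply: iff_trans (def e') _.
  have h := relation_ofE (A := Delta) (r := less_def)
    (e := fun z => if z == 0 then e' x else e' y) (t := map_tuple e' xs).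
  have {}h := h (esym (congr1 (fun t : 2.-tuple nat => [seq e' z | z <- t]) exs)).
  exact: iff_trans h _.
have /target_less luv' : less (e x) (e y) by rewrite ex ey.
have /target_less := (sat_bijective (A := def_structure Delta ds) e phi bijg empty).1 luv'.
by rewrite /= ex ey gu gv => lvu; apply: (irr u (tr _ _ _ luv lvu)).
Qed.

End Reduction.

Lemma Expr_pp_realized N d n : (forall n, grants N d n (d n)) ->
  Expr_pp (generic d) (pattern_instance n) <-> ~ N n.
Proof.
move=> gen; apply: iff_trans _ (realizedP n gen); split=> [[phi _]|].
  exact: (defines_realized gen).
move=> /realized_defines; eexists; last by eassumption.
by eexists _, _.
Qed.

Lemma Expr_ep_realized N d n : (forall n, grants N d n (d n)) ->
  Expr_ep (generic d) (pattern_instance n) <-> ~ N n.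
Proof.
move=> gen; apply: iff_trans _ (realizedP n gen); split=> [[phi _]|].
  exact: (defines_realized gen).
move=> /realized_defines; eexists; last by eassumption.
by eexists _, _.
Qed.

(** The recursive functions that accept the instance numbered by their own code. *)
Definition diagonal : set nat := fun n => exists2 f, recfun_code f = n &
  rec_eval f [:: expr_code (pattern_instance n)] 1.

(** A function that decides [Q] accepts its own instance exactly if it is not in
    [diagonal], that is, if it does not accept it. *)
Lemma diagonal_undecidable (Q : expr_instance odg_signature -> Prop) :
  (forall n, Q (pattern_instance n) <-> ~ diagonal n) ->
  undecidable (@expr_code odg_signature) Q.
Proof.
move=> QN [f /(_ (pattern_instance (recfun_code f)))[yes no]].
have [Nf|nNf] := pselect (diagonal (recfun_code f)).
  have [f' /recfun_code_inj -> ev1] := Nf.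
  have /no ev0 : ~ Q (pattern_instance (recfun_code f)) by move=> /QN.
  by have := rec_eval_fun ev1 ev0.
by apply: (nNf); exists f => //; apply/yes/QN.
Qed.

Theorem proposition3 :
  exists Delta : structure odg_signature,
    [/\ countable [set: Delta]%classic /\ infinite_set [set: Delta]%classic,
        ordered_digraph Delta,
        homogeneous Delta,
        ramsey Delta &
        undecidable (@expr_code odg_signature) (Expr_pp Delta) /\
        undecidable (@expr_code odg_signature) (Expr_ep Delta)].
Proof.
have [d gen] := generic_sequence diagonal; exists (generic d); split.
- by split; [exact: generic_countable | exact: generic_infinite].
- exact: generic_ordered gen.
- exact: generic_homogeneous gen.
- exact: generic_ramsey gen.
split; apply: diagonal_undecidable => n.
- exact: Expr_pp_realized gen.
- exact: Expr_ep_realized gen.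
Qed.
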